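(* Let $0<\alpha<n$ and $1<p<\infty$. Given a pair of weights $(u,v)$ on $\mathbb R^n$, suppose that for some $r>1$ there is a constant $C<\infty$ such that for all cubes $Q$, $$|Q|^{\alpha/n}\cdot\left(\frac1{|Q|}\int_Q u(x)^r\,dx\right)^{1/(rp)}\left(\frac1{|Q|}\int_Q v(x)^{-p'/p}\,dx\right)^{1/p'}\le C.$$ If $\theta$ satisfies the $\mathcal D_\kappa$ condition with $0\le\kappa<1$ and $u\in\Delta_2$, then the fractional integral operator $I_\alpha$ is bounded from $\mathcal M^{p,\theta}(v,u)$ into $W\mathcal M^{p,\theta}(u)$; that is, there is a constant $C'>0$ such that $\|I_\alpha f\|_{W\mathcal M^{p,\theta}(u)}\le C'\|f\|_{\mathcal M^{p,\theta}(v,u)}$ for all $f\in\mathcal M^{p,\theta}(v,u)$.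
   Context: The fractional integral operator (Riesz potential) on $\mathbb R^n$ is $I_\alpha f(x)=\frac1{\gamma(\alpha)}\int_{\mathbb R^n}\frac{f(y)}{|x-y|^{n-\alpha}}\,dy$, with $\gamma(\alpha)=\pi^{n/2}2^\alpha\Gamma(\alpha/2)/\Gamma((n-\alpha)/2)$. Here $1/p+1/p'=1$. A weight is a non-negative locally integrable function $w$ on $\mathbb R^n$; $w(E)=\int_E w(x)\,dx$ for measurable $E$. A weight $w$ is in $\Delta_2$ if there is a constant $C>0$ such that $w(2B)\le C\,w(B)$ for every ball $B$ ($2B$ being the concentric ball with twice the radius). All cubes have sides parallel to the coordinate axes. For $0\le\kappa<1$, $\theta$ satisfies the $\mathcal D_\kappa$ condition if $\theta$ is a positive increasing (in the wide sense; constants such as $\theta\equiv1$ are admitted) function on $(0,+\infty)$ and there is a constant $C>0$ such that $\frac{\theta(\xi)}{\xi^\kappa}\le C\,\frac{\theta(\xi')}{(\xi')^\kappa}$ for all $0<\xi'<\xi<+\infty$. For $1\le p<\infty$ and weights $u,v$, $\mathcal M^{p,\theta}(v,u)$ is the space of all $f\in L^p_{loc}(v)$ with $\|f\|_{\mathcal M^{p,\theta}(v,u)}:=\sup_B\left(\frac1{\theta(u(B))}\int_B|f(x)|^pv(x)\,dx\right)^{1/p}<\infty$, and $W\mathcal M^{p,\theta}(v)$ is the space of all measurable $f$ with $\|f\|_{W\mathcal M^{p,\theta}(v)}:=\sup_B\sup_{\sigma>0}\frac1{\theta(v(B))^{1/p}}\,\sigma\cdot\left[v(\{x\in B:|f(x)|>\sigma\})\right]^{1/p}<\infty$;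 the suprema over $B$ are over all balls in $\mathbb R^n$. By the paper's convention these notions (and $\Delta_2$) may equivalently be defined with cubes in place of balls, whichever is more convenient. *)

(* Defs.v *)
From HB Require Import structures.
From mathcomp Require Import all_boot all_order all_algebra.
From mathcomp Require Import all_classical all_reals all_analysis.
From mathcomp Require Import measurable_realfun.

Set Implicit Arguments.
Unset Strict Implicit.
Unset Printing Implicit Defensive.

Import Order.TTheory GRing.Theory Num.Theory.
Import numFieldNormedType.Exports.

Local Open Scope classical_set_scope.
Local Open Scope ring_scope.

Section tuple_lebesgue.
Context {R : realType}.
Local Notation M := (measurableTypeR R).

Definition tcons n (z : M * n.-tuple M) : n.+1.-tuple M :=
  [the n.+1.-tuple M of z.1 :: z.2].

Lemma measurable_tcons n : measurable_fun [set: M * n.-tuple M] (@tcons n).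
Proof. exact: measurable_cons. Qed.

Section step.
Variables (n : nat) (m : {sigma_finite_measure set (n.-tuple M) -> \bar R}).

Definition lebesgue_step : set (n.+1.-tuple M) -> \bar R :=
  pushforward (lebesgue_measure \x m)%E (@tcons n).

Let step0 : lebesgue_step set0 = 0%E.
Proof. by rewrite /lebesgue_step /pushforward preimage_set0 measure0. Qed.

Let step_ge0 A : (0 <= lebesgue_step A)%E.
Proof. exact: (measure_ge0 (lebesgue_measure \x m)%E). Qed.

Let step_sigma_additive : semi_sigma_additive lebesgue_step.
Proof.
move=> F mF tF mUF; rewrite /lebesgue_step /pushforward preimage_bigcup.
have mt A : measurable A -> measurable (@tcons n @^-1` A).
  by move=> mA; rewrite -[X in measurable X]setTI; exact: measurable_tcons.
apply: (@measure_semi_sigma_additive _ _ _ (lebesgue_measure \x m)%E).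
- by move=> k; apply: mt; exact: mF.
- apply/trivIsetP => /= i j _ _ ij; rewrite -preimage_setI.
  by move/trivIsetP : tF => /(_ _ _ _ _ ij) ->//; rewrite preimage_set0.
- by rewrite -preimage_bigcup; exact: mt.
Qed.

HB.instance Definition _ := isMeasure.Build _ _ _ lebesgue_step
  step0 step_ge0 step_sigma_additive.

Let step_sigma_finite : sigma_finite setT lebesgue_step.
Proof.
have /sigma_finiteP[F [TF ndF mF]] := sigma_finiteT (@lebesgue_measure R).
have /sigma_finiteP[G [TG ndG mG]] := sigma_finiteT m.
pose g (x : n.+1.-tuple M) : M * n.-tuple M := (thead x, [tuple of behead x]).
have gK : cancel (@tcons n) g.
  by move=> [a t]; rewrite /g; congr pair; apply: val_inj.
have mg : measurable_fun setT g.
  by apply: measurable_fun_pair; [exact: measurable_tnth | exact: measurable_behead].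
exists (fun k => g @^-1` (F k `*` G k)).
  apply/esym; rewrite -subTset => x _; rewrite /g.
  have [i _ Fi] : (\bigcup_k F k) (thead x) by rewrite -TF.
  have [j _ Gj] : (\bigcup_k G k) [tuple of behead x] by rewrite -TG.
  exists (maxn i j) => //; split => /=.
  - by move: Fi; exact/subsetPset/ndF/leq_maxl.
  - by move: Gj; exact/subsetPset/ndG/leq_maxr.
move=> k; have [mFk Fkoo] := mF k; have [mGk Gkoo] := mG k.
have mFG : measurable (F k `*` G k) by exact: measurableX.
split; first by rewrite -[X in measurable X]setTI; exact: mg.
rewrite /lebesgue_step /pushforward -comp_preimage.
rewrite (_ : g \o @tcons n = id); last by apply/funext => z /=; exact: gK.
by rewrite preimage_id product_measure1E// lte_mul_pinfty// ge0_fin_numE.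
Qed.

HB.instance Definition _ := @Measure_isSigmaFinite.Build _ _ _ lebesgue_step
  step_sigma_finite.

End step.

(* Lebesgue measure on the product (Borel) sigma-algebra, obtained by iterating
   the binary product; for n = 0 it is the unit mass on the empty tuple. *)
Fixpoint borel_lebesgue n : {sigma_finite_measure set (n.-tuple M) -> \bar R} :=
  match n with
  | 0 => \d_([tuple] : 0.-tuple M)
  | k.+1 => lebesgue_step (borel_lebesgue k)
  end.

End tuple_lebesgue.

(* R^n with the sigma-algebra of Lebesgue measurable sets: Caratheodory's
   extension of a sigma-finite measure is its completion. *)
Definition Rn (R : realType) (n : nat) :=
  caratheodory_type (mu_ext (@borel_lebesgue R n)).
HB.instance Definition _ R n := Measurable.on (Rn R n).

Definition lebesgue (R : realType) (n : nat) : set (Rn R n) -> \bar R :=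
  @completed_measure_extension _ _ _ (@borel_lebesgue R n).
HB.instance Definition _ R n := Measure.on (@lebesgue R n).
Lemma lebesgue_sigma_finite (R : realType) (n : nat) :
  sigma_finite setT (@lebesgue R n).
Proof. exact/completed_measure_extension_sigma_finite/sigma_finiteT. Qed.
HB.instance Definition _ R n := @Measure_isSigmaFinite.Build _ _ _
  (@lebesgue R n) (@lebesgue_sigma_finite R n).

Section morrey.
Context {R : realType} {n : nat}.
Local Notation E := (Rn R n).
Local Notation lambda := (@lebesgue R n).
Implicit Types (w u v f : E -> R) (p alpha kappa : R) (theta : R -> R).

Definition l2dist (x y : E) : R :=
  Num.sqrt (\sum_(i < n) (tnth x i - tnth y i) ^+ 2).

Definition eball (x : E) (rho : R) : set E := [set y | l2dist x y < rho].

Definition cube (a : E) (l : R) : set E :=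
  [set y | forall i : 'I_n, tnth a i <= tnth y i <= tnth a i + l].

(* Every compact set lies in a ball, and closed balls are compact, so local
   integrability may be tested on balls. *)
Definition weight w : Prop :=
  (forall x, 0 <= w x) /\
  (forall x rho, 0 < rho -> lambda.-integrable (eball x rho) (EFin \o w)).

Definition wmeasure w (A : set E) : \bar R := (\int[lambda]_(x in A) (w x)%:E)%E.

Definition Delta2 w : Prop := exists2 C : R, 0 < C &
  forall x rho, 0 < rho ->
    (wmeasure w (eball x (2 * rho)) <= C%:E * wmeasure w (eball x rho))%E.

Definition Dcond kappa theta : Prop :=
  [/\ forall xi, 0 < xi -> 0 < theta xi,
      forall xi xi', 0 < xi -> xi <= xi' -> theta xi <= theta xi' &
      exists2 C : R, 0 < C & forall xi' xi, 0 < xi' -> xi' < xi ->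
        theta xi / xi `^ kappa <= C * (theta xi' / xi' `^ kappa)].

Definition Gamma (s : R) : R :=
  \int[lebesgue_measure]_(t in `]0, +oo[) (t `^ (s - 1) * expR (- t)).

Definition riesz_gamma alpha : R :=
  pi `^ (n%:R / 2) * 2 `^ alpha * Gamma (alpha / 2) / Gamma ((n%:R - alpha) / 2).

(* The integral is a difference of the integrals of the positive and negative
   parts, with +oo - +oo = -oo: at a point where the defining integral is not
   absolutely convergent the value is infinite. *)
Definition riesz alpha f (x : E) : \bar R :=
  ((riesz_gamma alpha)^-1%:E *
   \int[lambda]_y (f y / l2dist x y `^ (n%:R - alpha))%:E)%E.

Definition Lploc p v f : Prop :=
  measurable_fun setT f /\
  (forall x rho, 0 < rho ->
     lambda.-integrable (eball x rho) (fun y => (`|f y| `^ p * v y)%:E)).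

(* [theta] is only constrained on ]0, +oo[. Its value at 0 matters only when a
   ball is null for the weight, and for a doubling weight that means w = 0 a.e. *)
Definition morrey_norm p theta v u f : \bar R :=
  ereal_sup [set s | exists x rho, 0 < rho /\
    s = (((theta (fine (wmeasure u (eball x rho))))^-1%:E *
          \int[lambda]_(y in eball x rho) (`|f y| `^ p * v y)%:E) `^ p^-1)%E].

Definition morrey p theta v u f : Prop :=
  Lploc p v f /\ (morrey_norm p theta v u f < +oo)%E.

Definition wmorrey_norm p theta v (g : E -> \bar R) : \bar R :=
  ereal_sup [set s | exists x rho sigma, [/\ 0 < rho, 0 < sigma &
    s = ((theta (fine (wmeasure v (eball x rho))) `^ p^-1)^-1%:E *
         (sigma%:E *
          wmeasure v [set y | eball x rho y /\ sigma%:E < `|g y|] `^ p^-1))%E]].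

Definition wmorrey p theta v (g : E -> \bar R) : Prop :=
  measurable_fun setT g /\ (wmorrey_norm p theta v g < +oo)%E.

End morrey.

(* Main.v *)
Require Import Defs.
From mathcomp Require Import all_boot all_order all_algebra.
From mathcomp Require Import all_classical all_reals all_analysis.
From mathcomp Require Import measurable_realfun.
From mathcomp Require Import ring lra.

Set Implicit Arguments.
Unset Strict Implicit.
Unset Printing Implicit Defensive.

Import Order.TTheory GRing.Theory Num.Theory.
Import numFieldNormedType.Exports.

Local Open Scope classical_set_scope.
Local Open Scope ring_scope.

(** The potential of f splits, at a point x of a ball B of radius rho, into the
integral over the points at distance at most 3 rho / 8 from x and the integral
over the rest.
Write h = |f|, phi = h^p v, W = u^r, q = 1/r and, for a set A inside a cube of
side l, D(A) = (l^n)^(1-q) W(A)^q.  Hoelder gives u(A) <= D(A), and Hoelder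
together with the bump condition gives the one inequality that drives both parts:
  l^(alpha-n) h(A) <= C (phi(A) / D(A))^(1/p)      ([cube_ratio]).

The far part ([far_strong]).  It is at most a sum over the cubes Q_m of side
comparable with 2^m rho concentric with B, whose terms are the left-hand sides
above.  The Morrey norm, the growth of theta and doubling bound phi(Q_m) by a multiple of
theta(u(B)) (D(Q_m) / u(B))^kappa, while u(B) <= D(Q_0) is at most
2^(-mn(1-q)) D(Q_m) up to a constant: the exponent r > 1 alone produces geometric
decay, as kappa < 1, and the far part is bounded on B by a multiple of
(theta(u(B)) / u(B))^(1/p) times the Morrey norm of f.

The near part ([near_weak]).  It needs the two-weight weak type inequality
  t^p u{near > t} <= C phi(B'), with B' a fixed dilate of B.
The integral is at most a sum, over dyadic cells containing x, of
side^(alpha-n) h(cell); by the one-third trick ([onethird_apart], [window]) it is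
enough to use the 2^n grids whose roots are shifted by a third of their side.
On one grid the inequality is a statement about a tree of nodes carrying the
numbers u, mu (volume), h, W and phi ([tree_weak_type]).  Along a branch one
keeps the last average g of h that was accepted, and accepts the average over
a new cell when it exceeds K g.  Between acceptances the terms form a
geometric series, so only accepted cells count.  The accepted cells that come
next below an accepted cell S cover at most the fraction 1/K of its volume, hence by Hoelder
the sum of their D is at most K^(-(1-q)) D(S): the capacity D shrinks by a
small factor whenever the sum grows by y = (phi(S) / D(S))^(1/p).  The function
  B(phi, D, t) = phi t^(1-p) / (t + (phi / D)^(1/p))     ([bell])
is superadditive in (phi, D), at most phi / t^p, at least a multiple of D when y is of the
order of t ([bell_large]), and satisfies B(phi, theta D, t - y) <= B(phi, D, t) for
y <= t/2 and theta small ([bell_shift]).  Induction on the depth of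
the tree then bounds the u-mass of the set where the sum exceeds t by a
multiple of B, hence of phi / t^p.

When u vanishes on some ball, doubling makes u null and both sides
of the claim are trivial. *)

(** * Weighted geometric means *)

Section gmean.
Context {R : realType}.
Implicit Types q s a b t : R.

Lemma powRV a s : 0 <= a -> a^-1 `^ s = (a `^ s)^-1.
Proof. by move=> a0; rewrite -powR_inv1// powRAC powR_inv1 ?powR_ge0. Qed.

(** With q = 1/r, mu a volume and W the integral of u^r, [gmean q mu W] is the
upper bound for the u-measure that Hoelder's inequality gives. *)
Definition gmean q a b : R := a `^ (1 - q) * b `^ q.

Lemma gmean_ge0 q a b : 0 <= gmean q a b.
Proof. by rewrite mulr_ge0 ?powR_ge0. Qed.

Lemma gmean_gt0 q a b : 0 < a -> 0 < b -> 0 < gmean q a b.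
Proof. by move=> a0 b0; rewrite mulr_gt0 ?powR_gt0. Qed.

Lemma gmean0l q b : q < 1 -> gmean q 0 b = 0.
Proof. by move=> q1; rewrite /gmean powR0 ?mul0r// subr_eq0 gt_eqF. Qed.

Lemma gmean0r q a : 0 < q -> gmean q a 0 = 0.
Proof. by move=> q0; rewrite /gmean [0 `^ q]powR0 ?mulr0// gt_eqF. Qed.

Lemma ler_gmean q a b a' b' : 0 < q < 1 -> 0 <= a -> 0 <= b -> a <= a' -> b <= b' ->
  gmean q a b <= gmean q a' b'.
Proof.
move=> /andP[q0 q1] a0 b0 aa bb.
rewrite ler_pM ?powR_ge0// ge0_ler_powR ?nnegrE ?subr_ge0 ?(ltW q1) ?(ltW q0)//.
- exact: le_trans aa.
- exact: le_trans bb.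
Qed.

Lemma gmean_young q a b : 0 < q < 1 -> 0 <= a -> 0 <= b ->
  gmean q a b <= (1 - q) * a + q * b.
Proof.
move=> /andP[q0 q1] a0 b0.
have q1' : 0 < 1 - q by rewrite subr_gt0.
have := @conjugate_powR R (a `^ (1 - q)) (b `^ q) (1 - q)^-1 q^-1.
rewrite !powR_ge0 !invr_gt0 q0 q1' !invrK subrK => /(_ isT isT isT isT erefl).
by rewrite -!powRrM !mulfV ?gt_eqF// !powRr1// (mulrC a) (mulrC b).
Qed.

Lemma gmeanZ q c d a b : 0 <= c -> 0 <= d -> 0 <= a -> 0 <= b ->
  gmean q (c * a) (d * b) = gmean q c d * gmean q a b.
Proof. by move=> *; rewrite /gmean !powRM//; ring. Qed.

(** Superadditivity: the discrete Hoelder inequality, by applying Young's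
inequality to the terms divided by the two sums. *)
Lemma gmean_sum q (I : finType) (a b : I -> R) : 0 < q < 1 ->
  (forall i, 0 <= a i) -> (forall i, 0 <= b i) ->
  \sum_i gmean q (a i) (b i) <= gmean q (\sum_i a i) (\sum_i b i).
Proof.
move=> q01 a0 b0; have /andP[q0 q1] := q01.
set A := \sum_i a i; set B := \sum_i b i.
have A0 : 0 <= A by exact: sumr_ge0.
have B0 : 0 <= B by exact: sumr_ge0.
have [AE|An0] := eqVneq A 0.
  rewrite AE gmean0l// big1// => i _.
  have -> : a i = 0.
    by apply/eqP; move/eqP : AE; rewrite psumr_eq0// => /allP/(_ i); apply; rewrite mem_index_enum.
  exact: gmean0l.
have [BE|Bn0] := eqVneq B 0.
  rewrite BE gmean0r// big1// => i _.
  have -> : b i = 0.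
    by apply/eqP; move/eqP : BE; rewrite psumr_eq0// => /allP/(_ i); apply; rewrite mem_index_enum.
  exact: gmean0r.
have Ap : 0 < A by rewrite lt_neqAle eq_sym An0.
have Bp : 0 < B by rewrite lt_neqAle eq_sym Bn0.
have h i : gmean q (a i) (b i) <= gmean q A B * ((1 - q) * (a i / A) + q * (b i / B)).
  rewrite -{1}(divfK An0 (a i)) -{1}(divfK Bn0 (b i)).
  rewrite ![_ / _ * _]mulrC gmeanZ ?divr_ge0//.
  by rewrite ler_wpM2l ?gmean_ge0// gmean_young// divr_ge0.
apply: (le_trans (ler_sum _ (fun i _ => h i))).
rewrite -mulr_sumr big_split/= -!mulr_sumr -!mulr_suml !mulfV//.
by rewrite !mulr1 subrK mulr1.
Qed.

End gmean.

(** * A Bellman function *)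

Section bellman.
Context {R : realType}.
Variables (p : R).
Hypothesis p1 : 1 < p.
Implicit Types phi D t : R.

Local Notation s := p^-1.

Lemma inv_exponent01 : 0 < s < 1.
Proof. by rewrite invr_gt0 (lt_trans _ p1)//= invf_lt1// (lt_trans _ p1). Qed.

(** Half the harmonic mean; it is a minimum of linear forms, which is why it is
superadditive and monotone. *)
Definition harm a b : R := a * b / (a + b).

Lemma harm_ge0 a b : 0 <= a -> 0 <= b -> 0 <= harm a b.
Proof. by move=> a0 b0; rewrite divr_ge0 ?mulr_ge0 ?addr_ge0. Qed.

Lemma harm_le_lin (l : R) a b : 0 <= a -> 0 <= b ->
  harm a b <= l ^+ 2 * a + (1 - l) ^+ 2 * b.
Proof.
move=> a0 b0; have [ab0|ab0] := eqVneq (a + b) 0.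
  by rewrite /harm ab0 invr0 mulr0 addr_ge0// mulr_ge0// sqr_ge0.
have ab : 0 < a + b by rewrite lt_neqAle eq_sym ab0 addr_ge0.
rewrite /harm ler_pdivrMr//.
suff : 0 <= (l * a - (1 - l) * b) ^+ 2 by lra.
exact: sqr_ge0.
Qed.

Lemma harm_lin a b : 0 <= a -> 0 <= b ->
  exists l : R, harm a b = l ^+ 2 * a + (1 - l) ^+ 2 * b.
Proof.
move=> a0 b0; have [ab0|ab0] := eqVneq (a + b) 0.
  have -> : a = 0 by lra.
  have -> : b = 0 by lra.
  by exists 0; rewrite /harm; ring.
by exists (b / (a + b)); rewrite /harm; field.
Qed.

Lemma harm_sum (I : finType) (a b : I -> R) :
  (forall i, 0 <= a i) -> (forall i, 0 <= b i) ->
  \sum_i harm (a i) (b i) <= harm (\sum_i a i) (\sum_i b i).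
Proof.
move=> a0 b0.
have A0 : 0 <= \sum_i a i by exact: sumr_ge0.
have B0 : 0 <= \sum_i b i by exact: sumr_ge0.
have [l ->] := harm_lin A0 B0.
rewrite !mulr_sumr -big_split/=; apply: ler_sum => i _; exact: harm_le_lin.
Qed.

Lemma harm_lel a b : 0 <= a -> 0 <= b -> harm a b <= a.
Proof. by move=> a0 b0; have := harm_le_lin 1 a0 b0; lra. Qed.

Lemma harm_ler a b b' : 0 <= a -> 0 <= b -> b <= b' -> harm a b <= harm a b'.
Proof.
move=> a0 b0 bb; have [l ->] := harm_lin a0 (le_trans b0 bb).
apply: (le_trans (harm_le_lin l a0 b0)).
by rewrite lerD2l ler_wpM2l// sqr_ge0.
Qed.

(** For positive arguments this is phi t^(1-p) / (t + (phi / D)^(1/p)), see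
[bellE].  The form chosen here shows the superadditivity and gives 0 when phi or
D vanishes. *)
Definition bell phi D t : R := t `^ (- p) * harm phi (t * gmean s phi D).

Lemma bell_ge0 phi D t : 0 <= phi -> 0 <= t -> 0 <= bell phi D t.
Proof.
move=> f0 t0; apply: mulr_ge0; first exact: powR_ge0.
by apply: harm_ge0 => //; rewrite mulr_ge0 ?gmean_ge0.
Qed.

Lemma bell_le phi D t : 0 <= phi -> 0 <= t -> bell phi D t <= t `^ (- p) * phi.
Proof. by move=> f0 t0; rewrite ler_wpM2l ?powR_ge0// harm_lel// mulr_ge0 ?gmean_ge0. Qed.

Lemma ler_bell phi D D' t : 0 <= phi -> 0 <= D -> D <= D' -> 0 <= t ->
  bell phi D t <= bell phi D' t.
Proof.
move=> f0 D0 DD t0; rewrite ler_wpM2l ?powR_ge0// harm_ler//; first by rewrite mulr_ge0 ?gmean_ge0.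
by rewrite ler_wpM2l// ler_gmean// inv_exponent01.
Qed.

(** Concavity in (phi, D) and homogeneity: masses spread over disjoint cells are
estimated by the total masses. *)
Lemma bell_sum (I : finType) (phi D : I -> R) t : 0 <= t ->
  (forall i, 0 <= phi i) -> (forall i, 0 <= D i) ->
  \sum_i bell (phi i) (D i) t <= bell (\sum_i phi i) (\sum_i D i) t.
Proof.
move=> t0 f0 D0; rewrite -mulr_sumr ler_wpM2l ?powR_ge0//.
apply: (le_trans (harm_sum _ _)) => // [i|].
  by rewrite mulr_ge0 ?gmean_ge0.
apply: harm_ler; first exact: sumr_ge0.
  by apply: sumr_ge0 => i _; rewrite mulr_ge0 ?gmean_ge0.
by rewrite -mulr_sumr ler_wpM2l// gmean_sum// inv_exponent01.
Qed.

Lemma bellE phi D t : 0 < phi -> 0 < D -> 0 < t ->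
  bell phi D t = t `^ (1 - p) * (phi / (t + (phi / D) `^ s)).
Proof.
move=> f0 D0 t0.
have y0 : 0 < (phi / D) `^ s by rewrite powR_gt0// divr_gt0.
rewrite /bell; have -> : gmean s phi D = phi / (phi / D) `^ s.
  rewrite /gmean powRB; last by rewrite (gt_eqF f0) implybT.
  rewrite powRr1 ?(ltW f0)//.
  rewrite powRM ?invr_ge0 ?(ltW f0) ?(ltW D0)// powRV ?(ltW D0)//.
  have := powR_gt0 s f0; have := powR_gt0 s D0 => ? ?.
  by field; rewrite !gt_eqF.
rewrite powRD; last by rewrite (gt_eqF t0) implybT.
rewrite powRr1 ?(ltW t0)// /harm.
set y := (phi / D) `^ s in y0 *.
by field; rewrite !gt_eqF// !addr_gt0 ?mulr_gt0.
Qed.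

(** When the accepted term (phi / D)^(1/p) is comparable with the level t, the
trivial bound of the measure by D is good enough. *)
Lemma bell_large phi D t : 0 < phi -> 0 < D -> 0 < t ->
  t / 2 <= (phi / D) `^ s -> D <= 3 * 2 `^ (p - 1) * bell phi D t.
Proof.
move=> f0 D0 t0 ty; have hp1 := p1; rewrite bellE//.
set y := _ `^ s in ty *.
have y0 : 0 < y by rewrite powR_gt0// divr_gt0.
have p0 : 0 < p by rewrite (lt_trans _ p1).
have yp : y `^ p = phi / D.
  by rewrite /y -powRrM mulVf ?gt_eqF// powRr1// ltW// divr_gt0.
have phiE : phi = D * (y * y `^ (p - 1)).
  by rewrite mulr_powRB1 ?ltW// yp; field; rewrite gt_eqF.
have h1 : t `^ (p - 1) <= 2 `^ (p - 1) * y `^ (p - 1).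
  rewrite -powRM ?(ltW y0)// ge0_ler_powR// ?nnegrE; lra.
have -> : 1 - p = - (p - 1) by ring.
rewrite powRN; set T := t `^ (p - 1) in h1 *.
have T0 : 0 < T by rewrite powR_gt0.
rewrite phiE.
rewrite -[leLHS]mulr1 [leRHS](_ : _ = D * (3 * (y / (t + y)) * (2 `^ (p - 1) * y `^ (p - 1) / T))); last first.
  by field; rewrite !gt_eqF// addr_gt0.
rewrite ler_pM2l// -[leLHS]mulr1 ler_pM//.
  by rewrite mulrA ler_pdivlMr ?addr_gt0//; lra.
by rewrite ler_pdivlMr// mul1r.
Qed.

Lemma powR_lin_bound (m : R) : exists2 A, 0 <= A &
  forall x : R, 0 <= x <= 1/2 -> ((1 - x)^-1) `^ m <= 1 + A * x.
Proof.
have [k mk] : exists k : nat, m <= k%:R.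
  by exists (Num.truncn `|m|).+1; rewrite (le_trans (ler_norm _))// ltW// truncnS_gt.
suff [A A0 hA] : exists2 A : R, 0 <= A & forall x : R, 0 <= x <= 1/2 -> (1 + 2 * x) ^+ k <= 1 + A * x.
  exists A => // x x01; apply: le_trans (hA _ x01).
  have x1 : 0 < 1 - x by lra.
  have i1 : 1 <= (1 - x)^-1 by rewrite invf_ge1//; lra.
  apply: (le_trans (ler_powR i1 mk)).
  rewrite powR_mulrn ?invr_ge0 ?(ltW x1)// lerXn2r ?nnegrE ?invr_ge0 ?(ltW x1)//; first by lra.
  rewrite -div1r ler_pdivrMr//; nra.
elim: k {m mk} => [|k [A A0 hA]]; first by exists 0 => // x _; rewrite expr0; lra.
exists (2 * A + 2) => [|x x01]; first by lra.
rewrite exprS; apply: (le_trans (ler_wpM2l _ (hA _ x01))); first by lra.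
have h : 0 <= A * (x * (1 - 2 * x)) by rewrite !mulr_ge0//; lra.
rewrite -subr_ge0 (_ : _ - _ = A * (x * (1 - 2 * x))) //; ring.
Qed.

(** Shrinking D by the factor theta = Th^(-p) multiplies (phi / D)^(1/p) by Th,
which raises the denominator t + y of [bell] to t + (Th - 1) y and so pays for
the loss of height from t to t - y. *)
Lemma bell_shift : exists2 Th : R, 1 <= Th &
  forall phi D t : R, 0 < phi -> 0 < D -> 0 < t -> (phi / D) `^ s <= t / 2 ->
  bell phi (Th `^ (- p) * D) (t - (phi / D) `^ s) <= bell phi D t.
Proof.
have [A A0 hA] := powR_lin_bound (p - 1).
exists (2 * A + 2) => [|phi D t f0 D0 t0]; first by lra.
set Th := 2 * A + 2; have Th0 : 0 < Th by rewrite /Th; lra.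
set y := _ `^ s => yt.
have y0 : 0 < y by rewrite powR_gt0// divr_gt0.
have p0 : 0 < p by rewrite (lt_trans _ p1).
rewrite !bellE ?mulr_gt0 ?powR_gt0//; last by lra.
have -> : (phi / (Th `^ (- p) * D)) `^ s = Th * y.
  rewrite powRN invfM invrK (mulrCA phi) powRM ?powR_ge0 ?divr_ge0 ?(ltW f0) ?(ltW D0)//.
  by rewrite -powRrM mulfV ?gt_eqF// powRr1// ltW.
rewrite -/y.
set x := y / t.
have x0 : 0 < x by rewrite divr_gt0.
have x1 : x <= 1/2 by rewrite ler_pdivrMr//; lra.
have yE : y = t * x by rewrite /x; field; rewrite gt_eqF.
have hx : 0 <= x <= 1/2 by rewrite x1 ltW.
have := hA x hx; clearbody x.
have x1' : 0 < 1 - x by lra.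
rewrite powRV ?(ltW x1')// -powRN opprB.
move=> hx'.
rewrite (_ : t - y = t * (1 - x)); last by rewrite yE; ring.
rewrite powRM ?(ltW t0)// ?(ltW x1')// -mulrA ler_pM2l ?powR_gt0//.
rewrite (_ : _ + y = t * (1 + x)); last by rewrite yE; ring.
rewrite (_ : _ + Th * y = t * (1 + (Th - 1) * x)); last by rewrite yE; ring.
rewrite mulrCA ler_pM2l//.
have q0 : 0 < 1 + (Th - 1) * x by rewrite /Th; nra.
rewrite ler_pdivrMr ?mulr_gt0//.
rewrite ler_pdivlMl ?mulr_gt0 ?addr_gt0//.
apply: (@le_trans _ _ (t * (1 + x) * (1 + A * x))); first by rewrite ler_wpM2l// ?mulr_ge0 ?addr_ge0 ?ltW.
rewrite -mulrA ler_pM2l// /Th -subr_ge0.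
have h : 0 <= A * (x * (1 - x)) by rewrite !mulr_ge0// ltW.
rewrite (_ : _ - _ = A * (x * (1 - x))) //; ring.
Qed.

End bellman.

(** * The weak type inequality on a tree *)

Section tree.
Context {R : realType} {V : Type} {I : finType}.
Variables (child : V -> I -> V) (u w mu h : V -> R).

(** The u-mass, at resolution N, of the part of v where the sum of w h / mu over
the proper descendants exceeds t.  The recursion on the threshold records a set
without mentioning points. *)
Fixpoint excess (N : nat) (v : V) (t : R) : R :=
  if N is N'.+1 then
    \sum_i excess N' (child v i) (t - w (child v i) * (h (child v i) / mu (child v i)))
  else if t < 0 then u v else 0.

Hypothesis u0 : forall v, 0 <= u v.
Hypothesis uD : forall v, \sum_i u (child v i) <= u v.

Lemma excess_le N v t : excess N v t <= u v.
Proof.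
elim: N v t => [|N IH] v t /=; first by case: ifP.
by apply: (le_trans _ (uD v)); apply: ler_sum => i _; exact: IH.
Qed.

Lemma excess_anti N v (t t' : R) : t <= t' -> excess N v t' <= excess N v t.
Proof.
elim: N v t t' => [|N IH] v t t' tt /=.
  case: ifPn => [t0|_]; last by case: ifP.
  by rewrite (le_lt_trans tt t0).
by apply: ler_sum => i _; apply: IH; rewrite lerD2r.
Qed.

Variables (W phi : V -> R) (p q rho : R).
Hypotheses (p1 : 1 < p) (q01 : 0 < q < 1).
Hypothesis (mu0 : forall v, 0 < mu v).
Hypothesis (W0 : forall v, 0 < W v).
Hypothesis (h0 : forall v, 0 <= h v).
Hypothesis (phi0 : forall v, 0 <= phi v).
Hypothesis (w0 : forall v, 0 < w v).
Hypothesis (WD : forall v, \sum_i W (child v i) <= W v).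
Hypothesis (hD : forall v, \sum_i h (child v i) <= h v).
Hypothesis (phiD : forall v, \sum_i phi (child v i) = phi v).
Hypothesis (wD : forall v i, w (child v i) = rho * w v).
Hypothesis (uleD : forall v, u v <= gmean q (mu v) (W v)).
Variables K c theta C : R.
Hypotheses (K0 : 0 < K) (c0 : 0 < c) (cE : c = c * rho + K * rho).
Hypothesis thetaE : K `^ (q - 1) = theta.
Hypothesis shift : forall phi D t : R, 0 < phi -> 0 < D -> 0 < t ->
  (phi / D) `^ p^-1 <= t / 2 ->
  bell p phi (theta * D) (t - (phi / D) `^ p^-1) <= bell p phi D t.
Hypothesis bump : forall v,
  (1 + c) * (w v * (h v / mu v)) <= (phi v / gmean q (mu v) (W v)) `^ p^-1.

Hypothesis C_ge0 : 0 <= C.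
Hypothesis large : forall phi D t : R, 0 < phi -> 0 < D -> 0 < t ->
  t / 2 <= (phi / D) `^ p^-1 -> D <= C * bell p phi D t.

(** A bound for the sum of gmean over the next accepted descendants of v when
the last accepted average is g: their volumes add up to at most h / (K g). *)
Let nextD v g := gmean q (h v / (K * g)) (W v).

Let nextD_ge0 v g : 0 <= nextD v g. Proof. exact: gmean_ge0. Qed.

Let nextD_sum v (g : R) : 0 < g -> \sum_i nextD (child v i) g <= nextD v g.
Proof.
move=> g0; have Kg : 0 < K * g by rewrite mulr_gt0.
apply: (le_trans (gmean_sum q01 _ _)) => [i|i|].
- by rewrite divr_ge0// ltW.
- exact: ltW.
apply: ler_gmean => //.
- by rewrite sumr_ge0// => i _; rewrite divr_ge0// ltW.
- by rewrite sumr_ge0// => i _; rewrite ltW.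
- by rewrite -mulr_suml ler_pM2r ?invr_gt0.
Qed.

(** The step at an accepted node.  Its own term, together with the geometric tail
that it generates, is at most y.  Either y is large and D alone suffices, or the
height drops by y while D drops by the factor theta. *)
Let excess_stop N v (g t : R) : 0 < g -> 0 < t -> K * g < h v / mu v ->
  (forall v' (g' t' : R), 0 < g' -> 0 < t' ->
     excess N v' (t' + c * w v' * g') <= C * bell p (phi v') (nextD v' g') t') ->
  forall t' : R, t - w v * (h v / mu v) <= t' ->
  excess N v t' <= C * bell p (phi v) (nextD v g) t.
Proof.
move=> g0 t0 Hg IH t1 tt1; have Kg : 0 < K * g by rewrite mulr_gt0.
have mv := mu0 v; have Wv := W0 v; have wv := w0 v.
set H := h v / mu v in Hg tt1; have H0 : 0 < H by exact: lt_trans Hg.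
set D := gmean q (mu v) (W v).
have D0 : 0 < D by exact: gmean_gt0.
have c0' := c0.
set y := (phi v / D) `^ p^-1.
have wHy : (1 + c) * (w v * H) <= y by exact: bump.
have y0 : 0 < y.
  apply: lt_le_trans wHy; apply: mulr_gt0; last exact: mulr_gt0.
  exact: addr_gt0.
have f0 : 0 < phi v.
  rewrite lt_neqAle phi0 andbT eq_sym; apply/eqP => fE.
  by move: y0; rewrite /y fE mul0r powR0 ?ltxx// invr_eq0 gt_eqF// (lt_trans _ p1).
have DleN : D <= nextD v g.
  apply: ler_gmean => //; [exact: ltW|exact: ltW|].
  by rewrite ler_pdivlMr// mulrC -ler_pdivlMr// ltW.
have DN : nextD v H = theta * D.
  rewrite -thetaE /nextD /D (_ : h v / (K * H) = K^-1 * mu v); last first.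
    have hE : h v = H * mu v by rewrite /H; field; rewrite gt_eqF.
    by rewrite hE; field; rewrite !gt_eqF.
  rewrite -[in LHS](mul1r (W v)) gmeanZ ?invr_ge0 ?(ltW K0) ?(ltW mv) ?(ltW Wv)//.
  congr (_ * _); rewrite /gmean powR1 mulr1 powRV ?(ltW K0)//.
  by rewrite -powRN opprB.
have [yt|yt] := leP (t / 2) y.
  apply: (le_trans (excess_le _ _ _)); apply: (le_trans (uleD v)).
  apply: (le_trans (large f0 D0 t0 yt)); apply: ler_wpM2l; first exact: C_ge0.
  by apply: ler_bell => //; exact: ltW.
apply: (@le_trans _ _ (excess N v (t - y + c * w v * H))).
  by apply: excess_anti; apply: le_trans tt1; lra.
have ty : 0 < t - y by lra.
apply: (le_trans (IH v H (t - y) H0 ty)).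
apply: ler_wpM2l; first exact: C_ge0.
rewrite DN.
apply: (le_trans (shift f0 D0 t0 (ltW yt))).
by apply: ler_bell => //; exact: ltW.
Qed.

(** The threshold t + c w g reserves the room c w g for the terms that will not be
accepted: they are at most K g times w, and w decays geometrically. *)
Lemma excess_bell N v (g t : R) : 0 < g -> 0 < t ->
  excess N v (t + c * w v * g) <= C * bell p (phi v) (nextD v g) t.
Proof.
elim: N v g t => [|N IH] v g t g0 t0 /=.
  have tc : 0 <= t + c * w v * g by rewrite addr_ge0 ?(ltW t0)// !mulr_ge0// ltW.
  rewrite ltNge tc /=.
  by apply: mulr_ge0; [exact: C_ge0|apply: bell_ge0; [exact: phi0|exact: ltW]].
apply: (@le_trans _ _ (\sum_i C * bell p (phi (child v i)) (nextD (child v i) g) t)).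
  apply: ler_sum => i _; set v' := child v i.
  have w'E : w v' = rho * w v by exact: wD.
  have [Hg|Hg] := leP (h v' / mu v') (K * g).
    apply: (le_trans _ (IH v' g t g0 t0)); apply: excess_anti.
    have -> : c * w v * g = c * w v' * g + w v' * (K * g).
      by rewrite w'E {1}cE; ring.
    suff : w v' * (h v' / mu v') <= w v' * (K * g) by lra.
    by rewrite ler_pM2l.
  apply: excess_stop => //.
  by rewrite lerD2r lerDl !mulr_ge0// ltW.
rewrite -mulr_sumr; apply: ler_wpM2l; first exact: C_ge0.
apply: (le_trans (bell_sum p1 (ltW t0) _ _)) => //.
rewrite phiD; apply: ler_bell => //; last exact: ltW; last exact: nextD_sum.
by apply: sumr_ge0.
Qed.

Lemma excess_weak N v (t : R) : 0 < t ->
  excess N v t <= C * 2 `^ p * (t `^ (- p) * phi v).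
Proof.
move=> t0; have wv := w0 v.
have t2 : 0 < t / 2 by rewrite divr_gt0.
(* Split t evenly: with this g the reserved room c w g of [excess_bell] is t / 2. *)
have g0 : 0 < t / (2 * (c * w v)) by rewrite divr_gt0// !mulr_gt0.
have := excess_bell N v g0 t2.
rewrite (_ : t / 2 + _ = t); last by field; rewrite !gt_eqF.
move=> /le_trans; apply; rewrite -mulrA; apply: ler_wpM2l; first exact: C_ge0.
apply: (le_trans (bell_le _ _ _ _)) => //; first exact: ltW.
rewrite mulrA ler_wpM2r// powRM ?invr_ge0 ?(ltW t0)// mulrC.
by rewrite powRV// powRN invrK.
Qed.

End tree.

(** The abstract two-weight weak type inequality; the constant depends neither on
the tree nor on its depth. *)
Theorem tree_weak_type (R : realType) (p q rho C0 : R) :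
  1 < p -> 0 < q < 1 -> 0 < rho < 1 -> 0 < C0 ->
  exists2 C : R, 0 < C & forall (V : Type) (I : finType) (child : V -> I -> V)
    (u w mu h W phi : V -> R),
    (forall v, 0 <= u v) -> (forall v, \sum_i u (child v i) <= u v) ->
    (forall v, 0 < mu v) -> (forall v, 0 < W v) -> (forall v, 0 <= h v) ->
    (forall v, 0 <= phi v) -> (forall v, 0 < w v) ->
    (forall v, \sum_i W (child v i) <= W v) ->
    (forall v, \sum_i h (child v i) <= h v) ->
    (forall v, \sum_i phi (child v i) = phi v) ->
    (forall v i, w (child v i) = rho * w v) ->
    (forall v, u v <= gmean q (mu v) (W v)) ->
    (forall v, w v * (h v / mu v) <= C0 * (phi v / gmean q (mu v) (W v)) `^ p^-1) ->
    forall N v t, 0 < t -> excess child u w mu h N v t <= C * (t `^ (- p) * phi v).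
Proof.
move=> p1 q01 rho01 C00; have p0 : 0 < p by exact: lt_trans p1.
have [Th Th1 shift] := bell_shift p1.
have /andP[r0 r1] := rho01; have /andP[q0 q1] := q01.
have Th0 : 0 < Th by exact: lt_le_trans Th1.
(* K is so large that the capacity drops by exactly the factor Th^(-p) that
[bell_shift] asks for. *)
have [K K0 KE] : exists2 K : R, 0 < K & K `^ (q - 1) = Th `^ (- p).
  exists (Th `^ (p / (1 - q))); first exact: powR_gt0.
  by rewrite -powRrM; congr (_ `^ _); field; rewrite subr_eq0 gt_eqF.
(* The room c w g must survive one generation: c rho for the children and K rho
for the child's own rejected term. *)
have [c c0 cE] : exists2 c : R, 0 < c & c = c * rho + K * rho.
  exists (K * rho / (1 - rho)); first by rewrite divr_gt0 ?mulr_gt0 ?subr_gt0.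
  by field; rewrite subr_eq0 gt_eqF.
have [C1 C10 large] : exists2 C1 : R, 0 < C1 & forall phi D t : R, 0 < phi -> 0 < D -> 0 < t ->
    t / 2 <= (phi / D) `^ p^-1 -> D <= C1 * bell p phi D t.
  by exists (3 * 2 `^ (p - 1)); [rewrite mulr_gt0 ?powR_gt0|exact: bell_large].
have kC : 0 < (1 + c) * C0 by rewrite mulr_gt0// addr_gt0.
exists (C1 * 2 `^ p * ((1 + c) * C0) `^ p); first by rewrite !mulr_gt0 ?powR_gt0.
move=> V I child u w mu h W phi u0 uD mu0 W0 h0 phi0 w0 WD hD phiD wD uleD bump N v t t0.
set k := (_ * C0) `^ p; have k0 : 0 <= k by exact: powR_ge0.
have := @excess_weak R V I child u w mu h u0 uD W (fun v => k * phi v)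
  p q rho p1 q01 mu0 W0 h0 _ w0 WD hD _ wD uleD K c _ C1 K0 c0 cE KE shift _ (ltW C10) large N v t t0.
move=> h1; apply: (le_trans (h1 _ _ _)) => //.
- by move=> v'; rewrite mulr_ge0.
- by move=> v'; rewrite -mulr_sumr phiD.
- move=> v'; rewrite -mulrA powRM ?divr_ge0 ?gmean_ge0//.
  rewrite /k -powRrM mulfV ?gt_eqF// powRr1 ?(ltW kC)//.
  by rewrite -[leRHS]mulrA ler_pM2l ?addr_gt0.
by rewrite le_eqVlt; apply/orP; left; apply/eqP; ring.
Qed.

(** * Real estimates for the distant annuli *)

Section far_real.
Context {R : realType}.

(** The exponent of U / D that remains after the growth of theta has used kappa
of it is 1 - kappa > 0, and U / D decays like G^m. *)
Lemma far_real (p kappa Ct Cq U D th M F G : R) (m : nat) :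
  0 < p -> 0 <= kappa < 1 -> 0 < U -> 0 < D -> 0 < th -> 0 <= M -> 0 <= Ct ->
  0 <= Cq -> 0 <= G -> 0 <= F -> U <= G ^+ m * D ->
  F <= Ct * th * (Cq * D / U) `^ kappa * M `^ p ->
  (F / D) `^ p^-1 <=
  (Ct * Cq `^ kappa) `^ p^-1 * M * (th / U) `^ p^-1 * (G `^ ((1 - kappa) / p)) ^+ m.
Proof.
move=> p0 /andP[k0 k1] U0 D0 th0 M0 Ct0 Cq0 G0 F0 UD FB.
have k1' : 0 < 1 - kappa by rewrite subr_gt0.
have UD' : U / D <= G ^+ m by rewrite ler_pdivrMr.
have e1 : F / D <= (Ct * Cq `^ kappa) * M `^ p * (th / U) * (U / D) `^ (1 - kappa).
  rewrite ler_pdivrMr//; apply: (le_trans FB).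
  have -> : (Cq * D / U) `^ kappa = Cq `^ kappa * ((U / D) `^ kappa)^-1.
    rewrite -mulrA powRM ?divr_ge0 ?(ltW U0) ?(ltW D0)//; congr (_ * _).
    by rewrite -powRV ?divr_ge0 ?(ltW U0) ?(ltW D0)// invf_div.
  have UDp : 0 < U / D by rewrite divr_gt0.
  rewrite powRB; last by rewrite (gt_eqF UDp) implybT.
  rewrite powRr1 ?(ltW UDp)//; have := powR_gt0 kappa UDp.
  move: (_ `^ kappa) => X X0.
  rewrite le_eqVlt; apply/orP; left; apply/eqP; field.
  by rewrite !gt_eqF.
have p'0 : 0 <= p^-1 by rewrite invr_ge0 ltW.
have b0 : 0 <= Ct * Cq `^ kappa by rewrite mulr_ge0 ?powR_ge0.
have t0 : 0 <= th / U by rewrite divr_ge0 ?ltW.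
apply: (@le_trans _ _ (((Ct * Cq `^ kappa) * M `^ p * (th / U) * (U / D) `^ (1 - kappa)) `^ p^-1)).
  apply: ge0_ler_powR => //; rewrite nnegrE.
    by rewrite divr_ge0// ltW.
  by rewrite !mulr_ge0 ?powR_ge0 ?invr_ge0 ?(ltW th0) ?(ltW U0).
rewrite powRM ?powR_ge0 ?mulr_ge0 ?powR_ge0 ?invr_ge0 ?(ltW th0) ?(ltW U0)//.
rewrite powRM ?mulr_ge0 ?powR_ge0 ?invr_ge0 ?(ltW th0) ?(ltW U0)//.
rewrite [(_ * M `^ p) `^ _]powRM ?mulr_ge0 ?powR_ge0//.
rewrite -[(M `^ p) `^ _]powRrM mulfV ?gt_eqF// powRr1//.
apply: ler_wpM2l; first by rewrite !mulr_ge0 ?powR_ge0.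
rewrite -powRrM -[leRHS]powR_mulrn ?powR_ge0// powRAC powR_mulrn//.
apply: ge0_ler_powR => //; rewrite ?nnegrE ?exprn_ge0 ?divr_ge0//; exact: ltW.
Qed.

Lemma geometric_series_le (c g : R) : 0 <= c -> 0 <= g < 1 ->
  (\sum_(m <oo) (c * g ^+ m)%:E <= (c / (1 - g))%:E)%E.
Proof.
move=> c0 /andP[g0 g1]; have g1' : 0 < 1 - g by rewrite subr_gt0.
apply: lime_le.
  by apply: is_cvg_nneseries => m _ _; rewrite lee_fin mulr_ge0 ?exprn_ge0.
apply: nearW => N; rewrite big_mkord sumEFin lee_fin -mulr_sumr ler_wpM2l//.
rewrite -div1r ler_pdivlMr//.
suff -> : (\sum_(i < N) g ^+ i) * (1 - g) = 1 - g ^+ N by rewrite gerBl exprn_ge0.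
elim: N => [|N IH]; first by rewrite big_ord0 mul0r expr0 subrr.
by rewrite big_ord_recr/= mulrDl IH exprS; ring.
Qed.

End far_real.

(** * Lebesgue measure and measurability in R^n *)

Section geometry.
Context {R : realType} {n : nat}.
Local Notation E := (Rn R n).
Local Notation M := (measurableTypeR R).
Local Notation lambda := (@lebesgue R n).

Lemma measurable_Rn (A : set (n.-tuple M)) : measurable A ->
  measurable (A : set E).
Proof. exact: caratheodory_measurable_mu_ext. Qed.

Lemma lebesgueE (A : set (n.-tuple M)) : measurable A ->
  lambda A = @borel_lebesgue R n A.
Proof. by move=> mA; rewrite /lebesgue /completed_measure_extension/= measurable_mu_extE. Qed.

Lemma measurable_fun_Rn d (T : measurableType d) (f : n.-tuple M -> T) :
  measurable_fun [set: n.-tuple M] f -> measurable_fun [set: E] (f : E -> T).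
Proof.
move=> mf _ Y mY; rewrite setTI; apply: measurable_Rn.
by rewrite -[X in measurable X]setTI; exact: mf.
Qed.

Lemma measurable_coord (i : 'I_n) : measurable_fun [set: E] (fun x : E => tnth x i : R).
Proof. apply: measurable_fun_Rn; exact: measurable_tnth. Qed.

End geometry.

Section box.
Context {R : realType}.
Local Notation M := (measurableTypeR R).

Definition box n (A : 'I_n -> set M) : set (n.-tuple M) :=
  [set y | forall i, A i (tnth y i)].

Lemma measurable_box n (A : 'I_n -> set M) : (forall i, measurable (A i)) ->
  measurable (box A).
Proof.
move=> mA.
have -> : box A = \bigcap_(i in [set: 'I_n]) ((fun y => tnth y i) @^-1` A i).
  by apply/seteqP; split => y /= h i; [move=> _|]; exact: h.
apply: fin_bigcap_measurable => // i _.
by rewrite -[X in measurable X]setTI; exact: measurable_tnth.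
Qed.

Lemma borel_lebesgue_box n (A : 'I_n -> set M) : (forall i, measurable (A i)) ->
  borel_lebesgue n (box A) = (\prod_(i < n) lebesgue_measure (A i))%E.
Proof.
elim: n A => [|n IH] A mA.
  rewrite big_ord0 /= diracE mem_set//.
  by case.
rewrite big_ord_recl -(IH (fun i => A (lift ord0 i)) (fun i => mA _)).
have mB : measurable (box (fun i => A (lift ord0 i))).
  by apply: measurable_box => i; exact: mA.
rewrite -product_measure1E; [|exact: mA|exact: mB].
rewrite [LHS]/= /lebesgue_step /pushforward; congr (product_measure1 _ _ _).
apply/seteqP; split => [[x y]|[x y]] /= h.
  split => [|i] /=; first exact: (h ord0).
  by have := h (lift ord0 i); rewrite tnthS.
case: h => h1 h2 i; case: (unliftP ord0 i) => [j ->|->]; last exact: h1.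
by rewrite tnthS; exact: h2.
Qed.

End box.

(** * Cubes, balls and measurability of the potential *)

Section metric.
Context {R : realType} {n : nat}.
Local Notation E := (Rn R n).
Local Notation M := (measurableTypeR R).
Local Notation lambda := (@lebesgue R n).

Definition cell (a : E) (l : R) : set E :=
  [set y | forall i : 'I_n, tnth a i <= tnth y i < tnth a i + l].

Lemma cubeE (a : E) (l : R) :
  cube a l = box (fun i : 'I_n => `[tnth a i, tnth a i + l]%classic : set M).
Proof. by apply/seteqP; split => y /= h i; have := h i; rewrite /= in_itv. Qed.

Lemma cellE (a : E) (l : R) :
  cell a l = box (fun i : 'I_n => `[tnth a i, (tnth a i + l)[%classic : set M).
Proof. by apply/seteqP; split => y /= h i; have := h i; rewrite /= in_itv. Qed.

Lemma measurable_cube (a : E) (l : R) : measurable (cube a l).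
Proof.
rewrite cubeE; apply: measurable_Rn; apply: measurable_box => i.
exact: measurable_itv.
Qed.

Lemma measurable_cell (a : E) (l : R) : measurable (cell a l).
Proof.
rewrite cellE; apply: measurable_Rn; apply: measurable_box => i.
exact: measurable_itv.
Qed.

Lemma lebesgue_cube (a : E) (l : R) : 0 < l -> lambda (cube a l) = (l ^+ n)%:E.
Proof.
move=> l0; rewrite cubeE lebesgueE; last first.
  by apply: measurable_box => i; exact: measurable_itv.
rewrite borel_lebesgue_box => [|i]; last exact: measurable_itv.
under eq_bigr => i _.
  rewrite lebesgue_measure_itv/= lte_fin ltrDl l0 -EFinD addrAC subrr add0r.
  over.
by rewrite prodEFin prodr_const card_ord.
Qed.

Lemma subset_cell_cube (a : E) (l : R) : cell a l `<=` cube a l.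
Proof. by move=> y h i; have /andP[-> /ltW ->] := h i. Qed.

Lemma subset_cube (a b : E) (l l' : R) :
  (forall i, tnth b i <= tnth a i /\ tnth a i + l <= tnth b i + l') ->
  cube a l `<=` cube b l'.
Proof.
move=> h y hy i; have [h1 h2] := h i; have /andP[h3 h4] := hy i.
by rewrite (le_trans h1 h3) (le_trans h4 h2).
Qed.

Lemma coord_le_l2dist (x y : E) i : `|tnth x i - tnth y i| <= l2dist x y.
Proof.
rewrite -sqrtr_sqr ler_wsqrtr// (bigD1 i)//= lerDl sumr_ge0// => j _.
exact: sqr_ge0.
Qed.

Lemma l2dist_le (x y : E) d : 0 <= d ->
  (forall i, `|tnth x i - tnth y i| <= d) -> l2dist x y <= n%:R * d.
Proof.
move=> d0 h; have nd : 0 <= n%:R * d by rewrite mulr_ge0.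
rewrite -(ger0_norm nd) -sqrtr_sqr ler_wsqrtr//.
apply: (@le_trans _ _ (\sum_(i < n) d ^+ 2)).
  apply: ler_sum => i _; rewrite -[leLHS]real_normK ?num_real//.
  by rewrite lerXn2r// nnegrE.
rewrite sumr_const card_ord exprMn -[leLHS]mulr_natl ler_wpM2r ?sqr_ge0//.
(* n d^2 <= (n d)^2, also when n = 0. *)
rewrite -natrX ler_nat; case: (n) => // m; exact: leq_pmulr.
Qed.

Lemma l2dist_ge0 (x y : E) : 0 <= l2dist x y.
Proof. exact: sqrtr_ge0. Qed.

Lemma l2distE (x y : E) :
  l2dist x y = (\sum_(i < n) (tnth x i - tnth y i) ^+ 2) `^ 2^-1.
Proof. by rewrite powR12_sqrt// sumr_ge0// => i _; exact: sqr_ge0. Qed.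

Lemma measurable_l2dist : measurable_fun setT (fun z : E * E => l2dist z.1 z.2).
Proof.
under eq_fun do rewrite l2distE.
apply: (measurableT_comp (measurable_powR _)) => /=.
apply: measurable_sum => i; apply: measurable_funX => /=.
apply: measurable_funB.
  exact: (measurableT_comp (measurable_coord i) measurable_fst).
exact: (measurableT_comp (measurable_coord i) measurable_snd).
Qed.

Lemma measurable_l2dist2 (x : E) : measurable_fun setT (l2dist x).
Proof.
rewrite (_ : l2dist x = fun y => (\sum_(i < n) (tnth x i - tnth y i) ^+ 2) `^ 2^-1).
  2: by apply/funext => y; rewrite l2distE.
apply: (measurableT_comp (measurable_powR _)) => /=.
apply: measurable_sum => i; apply: measurable_funX => /=.
by apply: measurable_funB; [exact: measurable_cst|exact: measurable_coord].
Qed.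

Lemma measurable_eball (x : E) (rho : R) : measurable (eball x rho).
Proof.
rewrite -[X in measurable X]setTI.
have -> : eball x rho = l2dist x @^-1` `]-oo, rho[%classic.
  by apply/seteqP; split => y /=; rewrite in_itv.
exact: measurable_l2dist2.
Qed.

(** Tonelli's theorem applied to the positive and negative parts of the kernel
times f. *)
Lemma measurable_riesz alpha (f : E -> R) : measurable_fun setT f ->
  measurable_fun setT (riesz alpha f).
Proof.
move=> mf; apply: emeasurable_funM; first exact: measurable_cst.
pose k (z : E * E) : \bar R := (f z.2 / l2dist z.1 z.2 `^ (n%:R - alpha))%:E.
have mk : measurable_fun setT k.
  apply/measurable_EFinP; apply: measurable_funM.
    exact: (measurableT_comp mf measurable_snd).
  under eq_fun do rewrite -powRN.
  apply: (measurableT_comp (measurable_powR _)).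
  exact: measurable_l2dist.
rewrite (_ : (fun x => _) = (fun x =>
   \int[lambda]_y (k^\+ (x, y)) - \int[lambda]_y (k^\- (x, y))))%E.
  apply: emeasurable_funB.
    apply: (@measurable_fun_fubini_tonelli_F _ _ _ _ _ lambda (k^\+)%E).
      exact: measurable_funepos.
    by move=> z; exact: funepos_ge0.
  apply: (@measurable_fun_fubini_tonelli_F _ _ _ _ _ lambda (k^\-)%E).
    exact: measurable_funeneg.
  by move=> z; exact: funeneg_ge0.
apply/funext => x; rewrite [LHS]integralE; congr (_ - _)%E.
  by apply: eq_integral => y _; rewrite !funeposE.
by apply: eq_integral => y _; rewrite !funenegE.
Qed.

Lemma measurable_riesz_level alpha sigma (f : E -> R) : measurable_fun setT f ->
  measurable [set y | (sigma%:E < `|riesz alpha f y|)%E].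
Proof.
move=> mf.
have mr : measurable_fun setT (fun y => `|riesz alpha f y|)%E.
  by apply: (measurableT_comp (@abse_measurable _ _)); exact: measurable_riesz.
rewrite -[X in measurable X]setTI.
rewrite (_ : [set y | _] = (fun y => `|riesz alpha f y|)%E @^-1` `]sigma%:E, +oo[%classic).
  by apply: mr; [exact: measurableT|exact: emeasurable_itv].
by apply/seteqP; split => y /=; rewrite in_itv/= andbT.
Qed.

Lemma subset_eball_cube (x : E) (rho : R) (a : E) l :
  (forall i, tnth a i <= tnth x i - rho /\ tnth x i + rho <= tnth a i + l) ->
  eball x rho `<=` cell a l.
Proof.
move=> h y hy i; have [h1 h2] := h i.
have := le_lt_trans (coord_le_l2dist x y i) hy.
rewrite ltr_norml => /andP[h3 h4]; apply/andP; split; lra.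
Qed.

Lemma subset_cube_eball (x : E) (rho d : R) (a : E) l : 0 <= d ->
  n%:R * d < rho ->
  (forall i, tnth x i - d <= tnth a i /\ tnth a i + l <= tnth x i + d) ->
  cube a l `<=` eball x rho.
Proof.
move=> d0 nd h y hy; apply: le_lt_trans nd; apply: l2dist_le => // i.
have [h1 h2] := h i; have /andP[h3 h4] := hy i.
rewrite ler_norml; apply/andP; split; lra.
Qed.

End metric.

(** * Integrals over sets in an abstract measure space *)

Section hoelder_on_set.
Context d (T : measurableType d) (R : realType).
Variable mu : {measure set T -> \bar R}.
Implicit Types (f g : T -> R) (A : set T).
Local Open Scope ereal_scope.

Lemma hoelder_on_set A f g (p q : R) : measurable A ->
  measurable_fun setT f -> measurable_fun setT g ->
  (forall x, (0 <= f x)%R) -> (forall x, (0 <= g x)%R) ->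
  (0 < p)%R -> (0 < q)%R -> (p^-1 + q^-1 = 1)%R ->
  \int[mu]_(x in A) (f x * g x)%:E <=
  (\int[mu]_(x in A) (f x `^ p)%:E) `^ p^-1 *
  (\int[mu]_(x in A) (g x `^ q)%:E) `^ q^-1.
Proof.
move=> mA mf mg f0 g0 p0 q0 pq.
pose F x := (f x * \1_A x)%R; pose G x := (g x * \1_A x)%R.
have mI : measurable_fun setT (\1_A : T -> R) by exact: measurable_indic.
have mF : measurable_fun setT F by exact: measurable_funM.
have mG : measurable_fun setT G by exact: measurable_funM.
have := hoelder mu mF mG p0 q0 pq.
have NE h r : (forall x, (0 <= h x)%R) -> (0 < r)%R ->
    Lnorm mu r%:E (EFin \o (fun x => (h x * \1_A x)%R)) =
    (\int[mu]_(x in A) (h x `^ r)%:E) `^ r^-1.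
  move=> h0 r0; rewrite unlock; congr (_ `^ _).
  rewrite [RHS]integral_mkcond; apply: eq_integral => x _.
  rewrite patchE /= indicE; case: ifPn => xA; rewrite ?mulr1 ?mulr0 ?ger0_norm//.
  by rewrite powR0// gt_eqF.
rewrite (NE f p f0 p0) (NE g q g0 q0) Lnorm1.
suff -> : \int[mu]_x `|(EFin \o (F \* G)%R) x| = \int[mu]_(x in A) (f x * g x)%:E by [].
rewrite [RHS]integral_mkcond; apply: eq_integral => x _.
rewrite patchE /= /F /G indicE; case: ifPn => xA; rewrite ?mulr1 ?mulr0 ?mul0r ?normr0//.
by rewrite ger0_norm ?mulr_ge0.
Qed.

End hoelder_on_set.

Section mass.
Context d {E : measurableType d} {R : realType}.
Variable lambda : {measure set E -> \bar R}.
Implicit Types (g : E -> R) (A B : set E).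
Local Open Scope ereal_scope.

Let wmeasure g A := \int[lambda]_(x in A) (g x)%:E.

Definition nonneg_meas g := (forall x, (0 <= g x)%R) /\ measurable_fun [set: E] g.

Lemma wmeasure_ge0 g A : nonneg_meas g -> 0 <= wmeasure g A.
Proof. by move=> [g0 _]; apply: integral_ge0 => x _; rewrite lee_fin. Qed.

Lemma nonneg_measE g A : nonneg_meas g -> measurable_fun A (EFin \o g).
Proof.
by move=> [_ mg]; apply/measurable_EFinP; apply: measurable_funS mg.
Qed.

Lemma le_wmeasure g A B : nonneg_meas g -> measurable A -> measurable B ->
  A `<=` B -> wmeasure g A <= wmeasure g B.
Proof.
move=> hg mA mB AB; apply: ge0_subset_integral => //.
  exact: nonneg_measE.
by move=> x _; rewrite lee_fin; case: hg.
Qed.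

Lemma wmeasure_finite_union (I : finType) (F : I -> set E) A g :
  nonneg_meas g -> (forall i, measurable (F i)) ->
  (forall i j, i != j -> F i `&` F j = set0) ->
  (forall x, A x <-> exists i, F i x) ->
  wmeasure g A = \sum_i wmeasure g (F i).
Proof.
move=> hg mF tF AF.
have -> : A = \big[setU/set0]_(i <- index_enum I) F i.
  rewrite -bigcup_seq; apply/seteqP; split => x.
    by move=> /AF[i Fi]; exists i => //=; exact: mem_index_enum.
  by move=> [i _ Fi]; apply/AF; exists i.
apply: ge0_integral_bigsetU => //.
- exact: index_enum_uniq.
- by apply/trivIsetP => i j _ _ ij; exact: tF.
- exact: nonneg_measE.
by move=> x _; rewrite lee_fin; case: hg.
Qed.

Lemma wmeasure_union_le (I : finType) (F : I -> set E) A g :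
  nonneg_meas g -> (forall i, measurable (F i)) -> measurable A ->
  (forall x, A x -> exists i, F i x) ->
  wmeasure g A <= \sum_i wmeasure g (F i).
Proof.
move=> hg mF mA AF; have [g0 mg] := hg.
have -> : \sum_i wmeasure g (F i) =
    \int[lambda]_x (\sum_i ((EFin \o g) \_ (F i)) x).
  rewrite ge0_integral_sum//.
  - by apply: eq_bigr => i _; rewrite [LHS]integral_mkcond.
  - move=> i; apply/(measurable_restrictT _ (mF i)); exact: nonneg_measE.
  - by move=> i x _; apply: erestrict_ge0 => y _; rewrite lee_fin.
rewrite /wmeasure integral_mkcond; apply: ge0_le_integral => //.
- by move=> x _; apply: erestrict_ge0 => y _; rewrite lee_fin.
- by apply/(measurable_restrictT _ mA); exact: nonneg_measE.
- by apply: emeasurable_sum => i; apply/(measurable_restrictT _ (mF i)); exact: nonneg_measE.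
move=> x _; rewrite [leLHS]patchE; case: ifPn => xA; last first.
  by apply: sume_ge0 => i _; apply: erestrict_ge0 => y _; rewrite lee_fin.
have [i Fi] : exists i, F i x by apply: AF; rewrite inE in xA.
rewrite (bigD1 i)//= patchE mem_set//= leeDl// sume_ge0// => j _.
by apply: erestrict_ge0 => y _; rewrite lee_fin.
Qed.

End mass.

(** * Consequences of the bump condition on one cube *)

Section bump.
Context d {T : measurableType d} {R : realType}.
Variable mu : {measure set T -> \bar R}.
Implicit Types (A Q : set T).
Local Open Scope ereal_scope.

Lemma measurable_inve_powR (v : T -> R) (s : R) : measurable_fun setT v ->
  measurable_fun setT (fun x => (v x `^ s)%:E^-1).
Proof.
move=> mv.
have mvs : measurable_fun setT (fun x => v x `^ s)%R.
  exact: (measurableT_comp (measurable_powR _)).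
rewrite (_ : (fun x => _) =
    fun x => if (v x `^ s)%R == 0%R then +oo else (v x `^ (- s))%:E); last first.
  by apply/funext => x; rewrite inver powRN.
apply: measurable_fun_ifT => //.
- apply: measurable_fun_eqr => //.
- by apply/measurable_EFinP; exact: (measurableT_comp (measurable_powR _)).
Qed.

Lemma integral_inve_gt0 (v : T -> R) (s : R) Q : measurable Q ->
  measurable_fun setT v -> (forall x, (0 <= v x)%R) -> 0 < mu Q ->
  0 < \int[mu]_(x in Q) (v x `^ s)%:E^-1.
Proof.
move=> mQ mv v0 Q0.
have i0 x : 0 <= (v x `^ s)%:E^-1 by rewrite inve_ge0 lee_fin powR_ge0.
rewrite lt0e integral_ge0// andbT; apply/eqP => I0.
have mi : measurable_fun Q (fun x => (v x `^ s)%:E^-1).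
  by apply: measurable_funS (measurable_inve_powR s mv).
have : \int[mu]_(x in Q) `|(v x `^ s)%:E^-1| = 0.
  by rewrite -[RHS]I0; apply: eq_integral => x _; rewrite gee0_abs.
move/(ae_eq_integral_abs _ mQ mi) => [N [mN N0 QN]].
move: Q0; rewrite ltNge => /negP; apply.
rewrite -N0 le_measure ?inE// => x Qx; apply: QN => /= /(_ Qx)/eqP.
by rewrite inve_eq0.
Qed.

(** Hoelder with exponents r and r': this is the bound u(A) <= gmean. *)
Lemma hoelder_gmean (u : T -> R) (r : R) A (V : R) : (1 < r)%R -> measurable A ->
  measurable_fun setT u -> (forall x, (0 <= u x)%R) -> mu A <= V%:E ->
  \int[mu]_(x in A) (u x)%:E <=
  V%:E `^ (1 - r^-1) * (\int[mu]_(x in A) (u x `^ r)%:E) `^ r^-1.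
Proof.
move=> r1 mA mf u0 AV; have r0 : (0 < r)%R by exact: lt_trans r1.
have q0 : (0 < 1 - r^-1)%R by rewrite subr_gt0 invf_lt1.
have := @hoelder_on_set _ _ _ mu A u (cst 1%R) r (1 - r^-1)^-1 mA mf
  (measurable_cst _) u0 (fun=> ler01) r0.
rewrite invr_gt0 q0 invrK => /(_ isT (subrKC _ _)).
under eq_integral do rewrite mulr1.
move=> /le_trans; apply; rewrite muleC lee_wpmul2r ?poweR_ge0//.
rewrite gt0_ler_poweR ?(ltW q0)//.
- rewrite in_itv/= leey andbT; apply: integral_ge0 => x _.
  by rewrite lee_fin powR_ge0.
- by rewrite in_itv/= leey andbT (le_trans _ AV).
- rewrite (_ : \int[mu]_(x in A) _ = mu A)//.
  by under eq_integral do rewrite powR1; rewrite integral_cst// mul1e.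
Qed.

Variables (p p' r : R) (u v : T -> R).
Hypotheses (p1 : (1 < p)%R) (pp' : (p^-1 + p'^-1 = 1)%R) (r1 : (1 < r)%R).
Hypotheses (mu_meas : measurable_fun setT u) (mv : measurable_fun setT v).
Hypotheses (u0 : forall x, (0 <= u x)%R) (v0 : forall x, (0 <= v x)%R).

Lemma conj_gt0 : (0 < p')%R.
Proof.
rewrite -invr_gt0; have -> : (p'^-1 = 1 - p^-1)%R by rewrite -pp' addrAC subrr add0r.
by rewrite subr_gt0 invf_lt1// (lt_trans _ p1).
Qed.

(** Where v vanishes the dual weight is infinite, so finiteness of its integral
makes v positive almost everywhere on A, and h = (h v^(1/p)) v^(-1/p) there. *)
Lemma hoelder_weight (h : T -> R) A : measurable A -> measurable_fun setT h ->
  (forall x, (0 <= h x)%R) ->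
  \int[mu]_(x in A) (v x `^ (p' / p))%:E^-1 < +oo ->
  \int[mu]_(x in A) (h x)%:E <=
  (\int[mu]_(x in A) (h x `^ p * v x)%:E) `^ p^-1 *
  (\int[mu]_(x in A) (v x `^ (p' / p))%:E^-1) `^ p'^-1.
Proof.
move=> mA mh h0 Sfin.
have p0 : (0 < p)%R by exact: lt_trans p1.
have p'0 := conj_gt0.
have s0 : (p' / p)%R != 0%R by rewrite gt_eqF// divr_gt0.
have ms := measurable_inve_powR (p' / p) mv.
have i0 x : 0 <= (v x `^ (p' / p))%:E^-1 by rewrite inve_ge0 lee_fin powR_ge0.
have mvp e : measurable_fun setT (fun x => v x `^ e)%R.
  exact: (measurableT_comp (measurable_powR _)).
pose f x := (h x * v x `^ p^-1)%R; pose g x := (v x `^ (- p^-1))%R.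
have mf : measurable_fun setT f by exact: measurable_funM.
have f0 x : (0 <= f x)%R by rewrite mulr_ge0 ?powR_ge0.
have g0 x : (0 <= g x)%R by rewrite powR_ge0.
apply: (@le_trans _ _ (\int[mu]_(x in A) (f x * g x)%:E)).
  apply: ae_ge0_le_integral => //.
  - by move=> x _; rewrite lee_fin.
  - by apply/measurable_EFinP; apply: measurable_funS mh.
  - by move=> x _; rewrite lee_fin mulr_ge0.
  - by apply/measurable_EFinP; apply: measurable_funS (measurable_funM mf (mvp _)).
  have isig : mu.-integrable A (fun x => (v x `^ (p' / p))%:E^-1).
    apply/integrableP; split; first exact: measurable_funS ms.
    by under eq_integral do rewrite gee0_abs//.
  apply: filterS (integrable_ae mA isig) => x + Ax => /(_ Ax).
  rewrite inver; case: ifPn => // vs0 _.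
  rewrite lee_fin /f /g -mulrA powRN mulfV ?mulr1//.
  by move: vs0; rewrite !powR_eq0 s0 andbT => /negbTE ->.
apply: (le_trans (hoelder_on_set mu mA mf (mvp _) f0 g0 p0 p'0 pp')).
rewrite (_ : \int[mu]_(x in A) (f x `^ p)%:E =
    \int[mu]_(x in A) (h x `^ p * v x)%:E); last first.
  apply: eq_integral => x _; rewrite powRM ?powR_ge0// -powRrM mulVf ?gt_eqF//.
  by rewrite powRr1.
rewrite lee_wpmul2l ?poweR_ge0// gt0_ler_poweR ?invr_ge0 ?(ltW p'0)//.
- by rewrite in_itv/= leey andbT integral_ge0// => x _; rewrite lee_fin powR_ge0.
- by rewrite in_itv/= leey andbT integral_ge0.
apply: ge0_le_integral => //.
- by move=> x _; rewrite lee_fin powR_ge0.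
- apply/measurable_EFinP.
  by apply: measurable_funS (measurableT_comp (measurable_powR _) (mvp _)).
- exact: measurable_funS ms.
move=> x _; rewrite inver; case: ifPn => [_|_]; first by rewrite leey.
by rewrite lee_fin /g -powRrM -powRN mulNr mulrC.
Qed.

Variables (A Q : set T) (V a C : R).
Hypotheses (mA : measurable A) (mQ : measurable Q) (AQ : A `<=` Q).
Hypotheses (V0 : (0 < V)%R) (QV : mu Q = V%:E).
Hypothesis bumpQ :
  V%:E `^ a * (V%:E^-1 * \int[mu]_(x in Q) (u x `^ r)%:E) `^ (r * p)^-1 *
  (V%:E^-1 * \int[mu]_(x in Q) (v x `^ (p' / p))%:E^-1) `^ p'^-1 <= C%:E.
Let WA := \int[mu]_(x in A) (u x `^ r)%:E.
Hypothesis WA0 : 0 < WA.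
Let WQ := \int[mu]_(x in Q) (u x `^ r)%:E.
Let S := \int[mu]_(x in Q) (v x `^ (p' / p))%:E^-1.

(** Both factors of the bump condition are positive (a power of v is never
infinite), so a finite product makes both of them finite. *)
Lemma bump_finite : WA <= WQ /\ WQ < +oo /\ S < +oo.
Proof.
have WAQ : WA <= WQ.
  apply: ge0_subset_integral => //.
    apply/measurable_EFinP.
    by apply: measurable_funS (measurableT_comp (measurable_powR _) mu_meas).
  by move=> x _; rewrite lee_fin powR_ge0.
have W0 : 0 < WQ by exact: lt_le_trans WAQ.
have S0 : 0 < S by apply: integral_inve_gt0 => //; rewrite QV.
have p0 : (0 < p)%R by exact: lt_trans p1.
have r0 : (0 < r)%R by exact: lt_trans r1.
have Vi : V%:E^-1 = V^-1%:E by rewrite inver gt_eqF.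
have e1 : ((r * p)^-1 != 0)%R by rewrite gt_eqF// invr_gt0 mulr_gt0.
have e2 : (p'^-1 != 0)%R by rewrite gt_eqF// invr_gt0 conj_gt0.
have VW x : 0 < x -> 0 < V%:E^-1 * x by move=> x0; rewrite Vi mule_gt0// lte_fin invr_gt0.
have Vy : V%:E^-1 * +oo = +oo by rewrite Vi gt0_muley// lte_fin invr_gt0.
split => //; split; rewrite ltNge leye_eq; apply/negP => /eqP xoo; move: bumpQ.
- rewrite -/WQ -/S xoo Vy poweRyr// gt0_muley ?poweR_gt0 ?lte_fin//.
  by rewrite gt0_mulye ?poweR_gt0 ?VW// leye_eq.
- rewrite -/WQ -/S xoo Vy poweRyr// gt0_muley ?leye_eq//.
  by rewrite mule_gt0// poweR_gt0// VW.
Qed.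

(** Solve the bump condition for the integral of the dual weight and insert it in
[hoelder_weight].  The powers of V add up to 1. *)
Lemma bump_ratio (h : T -> R) : measurable_fun setT h -> (forall x, (0 <= h x)%R) ->
  \int[mu]_(x in A) (h x `^ p * v x)%:E < +oo ->
  \int[mu]_(x in A) (h x)%:E < +oo /\
  (V `^ a * (fine (\int[mu]_(x in A) (h x)%:E) / V) <=
   C * (fine (\int[mu]_(x in A) (h x `^ p * v x)%:E) /
        gmean r^-1 V (fine WA)) `^ p^-1)%R.
Proof.
move=> mh h0 phioo; have [WAQ [WQoo Soo]] := bump_finite.
have p0 : (0 < p)%R by exact: lt_trans p1.
have r0 : (0 < r)%R by exact: lt_trans r1.
have p'0 := conj_gt0.
pose SA := \int[mu]_(x in A) (v x `^ (p' / p))%:E^-1.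
have i0 x : 0 <= (v x `^ (p' / p))%:E^-1 by rewrite inve_ge0 lee_fin powR_ge0.
have SAS : SA <= S.
  apply: ge0_subset_integral => //.
  by apply: measurable_funS (measurable_inve_powR _ mv).
have SAoo : SA < +oo by exact: le_lt_trans Soo.
set phiA := \int[mu]_(x in A) (h x `^ p * v x)%:E.
set hA := \int[mu]_(x in A) (h x)%:E.
have hb : hA <= phiA `^ p^-1 * SA `^ p'^-1 by exact: hoelder_weight.
have finE (x : \bar R) : 0 <= x -> x < +oo -> x = (fine x)%:E.
  by move=> x0 xoo; have /fineK -> : x \is a fin_num by rewrite ge0_fin_numE.
have SA0 : 0 <= SA by exact: integral_ge0.
have hA0 : 0 <= hA by apply: integral_ge0 => x _; rewrite lee_fin.
have phi0 : 0 <= phiA.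
  by apply: integral_ge0 => x _; rewrite lee_fin mulr_ge0 ?powR_ge0.
have WAE := finE _ (ltW WA0) (le_lt_trans WAQ WQoo).
have WQE := finE _ (le_trans (ltW WA0) WAQ) WQoo.
have SE := finE _ (le_trans SA0 SAS) Soo.
have SAE := finE _ SA0 SAoo.
have phiE := finE _ phi0 phioo.
have hAoo : hA < +oo by rewrite (le_lt_trans hb)// phiE SAE -EFinM ltry.
split => //.
have Vi : V%:E^-1 = V^-1%:E by rewrite inver gt_eqF.
move: bumpQ hb; rewrite -/WQ -/S WQE SE Vi phiE SAE (finE _ hA0 hAoo).
rewrite -!EFinM !lee_fin /=.
move: WA0 phi0 WAQ SAS; rewrite WAE WQE SE SAE phiE lte_fin !lee_fin /=.
have : (0 <= fine SA)%R by exact: fine_ge0.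
move: (fine WA) (fine WQ) (fine SA) (fine S) (fine phiA) (fine hA).
move=> wA w sA s phi H sA0 wA0 {}phi0 wAw sAs bb hb.
have VE : V = (V `^ (r * p)^-1 * V `^ p'^-1 * V `^ ((1 - r^-1) * p^-1))%R.
  rewrite -!powRD ?(gt_eqF V0) ?implybT// -[LHS](powRr1 (ltW V0)); congr (_ `^ _)%R.
  rewrite invfM; have -> : (p'^-1 = 1 - p^-1)%R by rewrite -pp' addrAC subrr add0r.
  by ring.
have gE : ((phi / gmean r^-1 V wA) `^ p^-1 =
    phi `^ p^-1 / (V `^ ((1 - r^-1) * p^-1) * wA `^ (r * p)^-1))%R.
  rewrite powRM ?invr_ge0 ?gmean_ge0// powRV ?gmean_ge0// powRM ?powR_ge0//.
  by rewrite -!powRrM (invfM r p).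
rewrite gE; move: bb.
rewrite !powRM ?invr_ge0 ?(ltW V0) ?(le_trans sA0 sAs)//; last exact: le_trans (ltW wA0) wAw.
rewrite !powRV ?(ltW V0)// [X in (H / X)%R]VE.
have wAw' : (wA `^ (r * p)^-1 <= w `^ (r * p)^-1)%R.
  rewrite ge0_ler_powR ?nnegrE ?invr_ge0 ?mulr_ge0 ?(ltW p0) ?(ltW r0) ?(ltW wA0)//.
  exact: le_trans (ltW wA0) wAw.
have sAs' : (sA `^ p'^-1 <= s `^ p'^-1)%R.
  apply: ge0_ler_powR; rewrite ?nnegrE ?invr_ge0 ?(ltW p'0)//.
  exact: le_trans sAs.
have X0 : (0 < V `^ (r * p)^-1)%R by exact: powR_gt0.
have Y0 : (0 < V `^ p'^-1)%R by exact: powR_gt0.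
have Z0 : (0 < V `^ ((1 - r^-1) * p^-1))%R by exact: powR_gt0.
have U0 : (0 < V `^ a)%R by exact: powR_gt0.
have wa0 : (0 < wA `^ (r * p)^-1)%R by exact: powR_gt0.
have f0 : (0 <= phi `^ p^-1)%R by exact: powR_ge0.
have sa0 : (0 <= sA `^ p'^-1)%R by exact: powR_ge0.
move: hb wAw' sAs' X0 Y0 Z0 U0 wa0 f0 sa0; clear VE gE.
move: (V `^ (r * p)^-1)%R (V `^ p'^-1)%R (V `^ ((1 - r^-1) * p^-1))%R (V `^ a)%R
  (wA `^ _)%R (w `^ _)%R (sA `^ _)%R (s `^ _)%R (phi `^ _)%R => X Y Z U wa ww sa ss f hb hw hs X0 Y0 Z0 U0 wa0 f0 sa0 hC.
apply: (@le_trans _ _ (U * (f * ss / (X * Y * Z))))%R.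
  rewrite ler_pM2l// ler_pM2r ?invr_gt0 ?mulr_gt0//.
  by apply: (le_trans hb); rewrite ler_wpM2l.
apply: (@le_trans _ _ ((U * (X^-1 * ww) * (Y^-1 * ss)) * (f / (Z * wa))))%R; last first.
  by rewrite ler_wpM2r// divr_ge0// mulr_ge0 ?ltW.
have -> : ((U * (X^-1 * ww) * (Y^-1 * ss)) * (f / (Z * wa)) =
   (U * (f * ss / (X * Y * Z))) * (ww / wa))%R.
  by field; rewrite !gt_eqF.
rewrite ler_peMr//; last by rewrite ler_pdivlMr ?mul1r.
have ss0 : (0 <= ss)%R by exact: le_trans hs.
by rewrite mulr_ge0 ?(ltW U0)// divr_ge0 ?mulr_ge0 ?(ltW X0) ?(ltW Y0) ?(ltW Z0).
Qed.

End bump.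

(** * Dyadic trees of cells in R^n *)

Section dyadic.
Context {R : realType} {n : nat}.
Local Notation E := (Rn R n).
Local Notation lambda := (@lebesgue R n).
Variable L : R.
Hypothesis L0 : 0 < L.

Definition side (k : nat) : R := L / 2 ^+ k.

Lemma side_gt0 k : 0 < side k.
Proof. by rewrite divr_gt0// exprn_gt0. Qed.

Lemma sideS k : side k = 2 * side k.+1.
Proof. by rewrite /side exprS; field; rewrite expf_neq0. Qed.

(** A cell is given by its lower corner and its generation; its side is
determined by the generation, hence positive for every node. *)
Definition node := (E * nat)%type.
Definition ncell (v : node) : set E := cell v.1 (side v.2).

Definition nchild (v : node) (e : {ffun 'I_n -> bool}) : node :=
  ([tuple tnth v.1 i + (if e i then side v.2.+1 else 0) | i < n] : E, v.2.+1).

Definition branch (v : node) (x : E) : {ffun 'I_n -> bool} :=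
  [ffun i => tnth v.1 i + side v.2.+1 <= tnth x i].

Lemma ncell_child v e x :
  ncell (nchild v e) x <-> ncell v x /\ branch v x = e.
Proof.
have Ss := sideS v.2; have s0 := side_gt0 v.2.+1; rewrite /ncell/=.
split => [h|[h <-]].
  split => [i|].
    have := h i; rewrite tnth_mktuple; case: ifP => _ /andP[h1 h2]; apply/andP; split; lra.
  apply/ffunP => i; have := h i; rewrite tnth_mktuple ffunE.
  case: (e i) => /andP[h1 h2]; first by rewrite h1.
  by apply/negbTE; rewrite -ltNge; lra.
move=> i; have /andP[h1 h2] := h i; rewrite tnth_mktuple ffunE.
by case: ifP => [h3|/negbT]; [|rewrite -ltNge => h3]; apply/andP; split; lra.
Qed.

Fixpoint descend (k : nat) (v : node) (x : E) : node :=
  if k is k'.+1 then descend k' (nchild v (branch v x)) x else v.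

Lemma descend_level k v x : (descend k v x).2 = (v.2 + k)%N.
Proof. by elim: k v => [|k IH] v /=; rewrite ?addn0// IH addSnnS. Qed.

Lemma descend_cell k v x : ncell v x -> ncell (descend k v x) x.
Proof. by elim: k v => [//|k IH] v vx /=; apply: IH; apply/ncell_child. Qed.

(** The corners of generation k lie on the lattice of mesh [side k] through the
corner of the root. *)
Lemma descend_lattice k v x i : exists m : nat,
  tnth (descend k v x).1 i = tnth v.1 i + m%:R * side (v.2 + k).
Proof.
elim: k v => [|k IH] v /=; first by exists 0%N; rewrite mul0r addr0.
have [m ->] := IH (nchild v (branch v x)).
rewrite /= tnth_mktuple -addSnnS; case: ifP => _; last first.
  by exists m; rewrite addr0.
exists (2 ^ k + m)%N; rewrite natrD mulrDl -addrA; congr (_ + (_ + _)).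
rewrite /side natrX exprD; field; by rewrite !expf_neq0.
Qed.

Variable val : node -> R.

Definition excess_set (N : nat) (v : node) (t : R) : set E :=
  [set x | ncell v x /\ t < \sum_(k < N) val (descend k.+1 v x)].

Lemma excess_setS N v t x : excess_set N.+1 v t x <->
  exists e, excess_set N (nchild v e) (t - val (nchild v e)) x.
Proof.
split => [[vx tx]|[e [/ncell_child[vx <-]]]].
  exists (branch v x); split; first exact/ncell_child.
  by move: tx; rewrite big_ord_recl/= ltrBlDl.
by rewrite ltrBlDl => tx; split => //; rewrite big_ord_recl.
Qed.

Lemma excess_set_sub_cell N v t : excess_set N v t `<=` ncell v.
Proof. by move=> x []. Qed.

Lemma measurable_excess_set N v t : measurable (excess_set N v t).
Proof.
elim: N v t => [|N IH] v t.
  have [t0|t0] := boolP (t < 0).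
    rewrite (_ : excess_set 0 v t = ncell v); first exact: measurable_cell.
    by apply/seteqP; split => x; [case|split => //; rewrite big_ord0].
  rewrite (_ : excess_set 0 v t = set0); first exact: measurable0.
  by apply/seteqP; split => x // [_]; rewrite big_ord0 (negbTE t0).
rewrite (_ : excess_set _ _ _ = \bigcup_(e in [set: {ffun 'I_n -> bool}])
    excess_set N (nchild v e) (t - val (nchild v e))).
  by apply: fin_bigcup_measurable => // e _; exact: IH.
apply/seteqP; split => x; first by move=> /excess_setS[e ?]; exists e.
by move=> [e _ ?]; apply/excess_setS; exists e.
Qed.

Lemma wmeasure_ncell (g : E -> R) v : nonneg_meas g ->
  wmeasure g (ncell v) = (\sum_e wmeasure g (ncell (nchild v e)))%E.
Proof.
move=> hg; apply: (wmeasure_finite_union lambda hg) => [e|e e' ee'|x].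
- exact: measurable_cell.
- apply/seteqP; split => x // [/ncell_child[_ h] /ncell_child[_ h']].
  by move: ee'; rewrite -h -h' eqxx.
- split => [vx|[e /ncell_child[]//]].
  by exists (branch v x); apply/ncell_child.
Qed.

Variables (u : E -> R) (w mu h : node -> R).
Hypothesis hu : nonneg_meas u.
Hypothesis ufin : forall v, (wmeasure u (ncell v) < +oo)%E.
Hypothesis valE : forall v, val v = w v * (h v / mu v).

Definition mass (g : E -> R) (A : set E) : R := fine (wmeasure g A).

(** Transfers the combinatorial bound on [excess] to the measure of the set. *)
Lemma wmeasure_excess_set N v t :
  (wmeasure u (excess_set N v t) <=
   (excess nchild (fun v => mass u (ncell v)) w mu h N v t)%:E)%E.
Proof.
elim: N v t => [|N IH] v t /=.
  case: ifPn => t0.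
    rewrite /mass fineK; last by rewrite ge0_fin_numE ?ufin//; exact: (wmeasure_ge0 lambda _ hu).
    apply: (le_wmeasure lambda hu); [exact: measurable_excess_set|exact: measurable_cell|].
    exact: excess_set_sub_cell.
  rewrite (_ : excess_set 0 v t = set0); first by rewrite /wmeasure integral_set0.
  by apply/seteqP; split => x // [_]; rewrite big_ord0 (negbTE t0).
apply: (@le_trans _ _ (\sum_e wmeasure u (excess_set N (nchild v e) (t - val (nchild v e))))%E).
  apply: (wmeasure_union_le lambda hu) => [e||x /excess_setS//]; exact: measurable_excess_set.
by rewrite -sumEFin; apply: lee_sum => e _; rewrite -valE; exact: IH.
Qed.

End dyadic.

(** * Domination of the kernel *)

Section cover.
Context d {T : measurableType d} {R : realType}.
Variable mu : {measure set T -> \bar R}.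
Local Open Scope ereal_scope.

Lemma integral_cover_le (h K : T -> R) (D : set T) (A : nat -> set T) (c : nat -> R) :
  nonneg_meas h -> nonneg_meas K -> measurable D ->
  (forall j, measurable (A j)) -> (forall j, (0 <= c j)%R) ->
  (forall y, D y -> (0 < K y)%R -> exists2 j, A j y & (K y <= c j)%R) ->
  \int[mu]_(y in D) (h y * K y)%:E <=
  \sum_(j <oo) (c j)%:E * \int[mu]_(y in A j) (h y)%:E.
Proof.
move=> [h0 mh] [K0 mK] mD mA c0 HA.
pose F j y := (c j)%:E * ((EFin \o h) \_ (A j)) y.
have F0 j y : 0 <= F j y.
  by rewrite mule_ge0 ?lee_fin// erestrict_ge0// => z _; rewrite lee_fin.
have mhA j : measurable_fun setT ((EFin \o h) \_ (A j)).
  apply/(measurable_restrictT _ (mA j)).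
  by apply/measurable_EFinP; exact: measurable_funS mh.
have mF j : measurable_fun setT (F j) by exact: measurable_funeM.
have -> : \sum_(j <oo) (c j)%:E * \int[mu]_(y in A j) (h y)%:E =
    \int[mu]_y \sum_(j <oo) F j y.
  rewrite integral_nneseries//; apply: eq_eseriesr => j _.
  rewrite ge0_integralZl ?lee_fin//; first by rewrite [in LHS]integral_mkcond.
  by move=> y _; rewrite erestrict_ge0// => z _; rewrite lee_fin.
rewrite integral_mkcond; apply: ge0_le_integral => //.
- by move=> y _; rewrite erestrict_ge0// => z _; rewrite lee_fin mulr_ge0.
- apply/(measurable_restrictT _ mD); apply/measurable_EFinP.
  by apply: measurable_funS (measurable_funM mh mK).
- by apply: ge0_emeasurable_sum => // j y _ _; exact: F0.
move=> y _; rewrite patchE; case: ifPn => yD; last exact: nneseries_ge0.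
have [Ky|Ky] := ltP 0%R (K y); last first.
  have -> : K y = 0%R by apply/eqP; rewrite eq_le Ky K0.
  by rewrite mulr0 nneseries_ge0.
have [j Ajy Kc] := HA y (set_mem yD) Ky.
apply: (@le_trans _ _ (F j y)).
  by rewrite /F patchE mem_set//= -EFinM lee_fin mulrC ler_wpM2r.
rewrite (nneseriesD1 (n := j))//.
by rewrite leeDl// nneseries_ge0.
Qed.

Lemma integral_bigcup_nd_le (g : T -> R) (F : nat -> set T) (M : \bar R) :
  nonneg_meas g -> (forall j, measurable (F j)) ->
  (forall j, F j `<=` F j.+1) ->
  (forall j, \int[mu]_(x in F j) (g x)%:E <= M) ->
  \int[mu]_(x in \bigcup_j F j) (g x)%:E <= M.
Proof.
move=> hg mF ndF FM.
have nd : nondecreasing_seq F by apply/nondecreasing_seqP => j; apply/subsetPset.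
have c := @ge0_nondecreasing_set_cvg_integral _ _ _ F (EFin \o g) mu nd mF
  (fun i => nonneg_measE (A := F i) hg) (fun i x _ => hg.1 x).
rewrite -(cvg_lim _ c)//; apply: lime_le; first by apply/cvg_ex; eexists; exact: c.
exact: nearW.
Qed.

Lemma integral_split (g : T -> R) (A : set T) : nonneg_meas g -> measurable A ->
  \int[mu]_x (g x)%:E = \int[mu]_(x in A) (g x)%:E + \int[mu]_(x in ~` A) (g x)%:E.
Proof.
move=> hg mA; rewrite -ge0_integral_setU ?setUv//.
- exact: measurableC.
- exact: nonneg_measE.
- by move=> x _; rewrite lee_fin hg.1.
- by rewrite disj_set2E setICr.
Qed.

Lemma abse_integral_le (f g : T -> R) : measurable_fun setT f -> nonneg_meas g ->
  `| \int[mu]_x (f x * g x)%:E | <= \int[mu]_x (`|f x| * g x)%:E.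
Proof.
move=> mf hg.
apply: le_trans (le_abse_integral mu _ _) _ => //.
  by apply/measurable_EFinP; apply: measurable_funM => //; exact: hg.2.
rewrite le_eqVlt; apply/orP; left; apply/eqP; apply: eq_integral => x _.
by rewrite /= normrM (ger0_norm (hg.1 x)).
Qed.

End cover.

Section scale.
Context {R : realType}.

Lemma near_scale (delta t : R) : 0 < t -> t <= delta ->
  exists j : nat, delta / 2 ^+ j.+1 < t <= delta / 2 ^+ j.
Proof.
move=> t0 td; have d0 : 0 < delta by exact: lt_le_trans td.
have [N HN] : exists N : nat, delta / 2 ^+ N < t.
  exists (Num.truncn (delta / t)).+1.
  rewrite ltr_pdivrMr ?exprn_gt0// mulrC -ltr_pdivrMr//.
  apply: (lt_le_trans (truncnS_gt _)); rewrite -natrX ler_nat.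
  by rewrite ltnW// ltn_expl.
elim: N HN => [|N IH] HN; first by move: HN; rewrite expr0 divr1 ltNge td.
by have [|h] := ltP (delta / 2 ^+ N) t; [exact: IH|exists N; rewrite HN h].
Qed.

Lemma far_scale (delta t : R) : 0 < delta -> delta < t ->
  exists m : nat, delta * 2 ^+ m < t <= delta * 2 ^+ m.+1.
Proof.
move=> d0 dt.
have [N HN] : exists N : nat, t <= delta * 2 ^+ N.
  exists (Num.truncn (t / delta)).+1.
  rewrite mulrC -ler_pdivrMr//.
  apply: (le_trans (ltW (truncnS_gt _))); rewrite -natrX ler_nat.
  by rewrite ltnW// ltn_expl.
elim: N HN => [|N IH] HN; first by move: HN; rewrite expr0 mulr1 leNgt dt.
by have [h|h] := leP t (delta * 2 ^+ N); [exact: IH|exists N; rewrite HN h].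
Qed.

End scale.

Section onethird_apart.
Context {R : realType}.

(** As 3 does not divide 2^k, the lattices of mesh s through a and a + 2^k s / 3
are at distance s / 3, so a point is not close to both. *)
Lemma onethird_apart (s a x : R) (k m m' : nat) : 0 < s ->
  `|x - (a + m%:R * s)| <= s / 8 ->
  `|x - (a + 2 ^+ k * s / 3 + m'%:R * s)| <= s / 8 -> False.
Proof.
move=> s0; rewrite !ler_norml => /andP[h1 h2] /andP[h3 h4].
have e1 : 2 ^+ k + 3 * m'%:R < 3 * m%:R + 1 :> R by rewrite -(ltr_pM2r s0); lra.
have e2 : 3 * m%:R < 2 ^+ k + 3 * m'%:R + 1 :> R by rewrite -(ltr_pM2r s0); lra.
rewrite -natrX -!natrM -natrD natr1 ltr_nat ltnS in e1.
rewrite -natrX -!natrM -natrD natr1 ltr_nat ltnS in e2.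
have /eqP e : (2 ^ k + 3 * m')%N == (3 * m)%N by rewrite eqn_leq e1 e2.
have : (3 %| 2 ^ k)%N by rewrite -(dvdn_addl _ (dvdn_mulr m' (dvdnn 3))) e dvdn_mulr.
by rewrite Euclid_dvdX// andbC.
Qed.

End onethird_apart.

(** * The near and the far part of the potential *)

Section local.
Context {R : realType} {n : nat}.
Local Notation E := (Rn R n).
Local Notation lambda := (@lebesgue R n).
Variables (x0 : E) (rho : R).
Hypothesis rho0 : 0 < rho.

Let L : R := 6 * rho.

Let L0 : 0 < L. Proof. by rewrite mulr_gt0. Qed.

(** The sides of the roots are 6 rho and the shifts 2 rho are a third of them. *)
Definition grid_root (t : {ffun 'I_n -> bool}) : node :=
  ([tuple tnth x0 i - 4 * rho + (if t i then 2 * rho else 0) | i < n] : E, 0%N).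

Lemma ball_coord x i : eball x0 rho x -> `|tnth x0 i - tnth x i| < rho.
Proof. by move=> h; exact: le_lt_trans (coord_le_l2dist _ _ _) h. Qed.

Lemma ball_sub_root x t : eball x0 rho x -> ncell L (grid_root t) x.
Proof.
move=> hx i; have := ball_coord i hx; rewrite ltr_norml => /andP[h1 h2].
have h := rho0; rewrite /= tnth_mktuple /side expr0 divr1 /L.
by case: ifP => _; apply/andP; split; lra.
Qed.

(** In each coordinate choose the shift whose lattice stays away from x. *)
Lemma window k x : eball x0 rho x -> exists t : {ffun 'I_n -> bool},
  forall y : E, (forall i, `|tnth x i - tnth y i| <= side L k / 8) ->
  ncell L (descend L k (grid_root t) x) y.
Proof.
move=> hx; have s0 : 0 < side L k by exact: side_gt0.
pose bad (b : bool) (i : 'I_n) := exists m : nat,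
  `|tnth x i - (tnth x0 i - 4 * rho + (if b then 2 * rho else 0) + m%:R * side L k)| <= side L k / 8.
have good i : ~ (bad false i /\ bad true i).
  move=> [[m hm] [m' hm']]; apply: (@onethird_apart _ (side L k) (tnth x0 i - 4 * rho) (tnth x i) k m m' s0).
    by move: hm; rewrite addr0.
  move: hm'; rewrite (_ : 2 ^+ k * side L k / 3 = 2 * rho)//.
  by rewrite /side /L; field; rewrite expf_neq0.
pose t : {ffun 'I_n -> bool} := [ffun i => `[< bad false i >]].
have tgood i : ~ bad (t i) i.
  rewrite ffunE; case: asboolP => // hb h; exact: (good i).
exists t => y hy; have xc := descend_cell L0 k (ball_sub_root t hx).
have lvl : (descend L k (grid_root t) x).2 = k by rewrite descend_level.
rewrite /ncell lvl in xc *; move=> i; have /andP[h1 h2] := xc i.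
have [m mE] := descend_lattice L k (grid_root t) x i.
rewrite /= tnth_mktuple add0n in mE.
have g1 : side L k / 8 < `|tnth x i - tnth (descend L k (grid_root t) x).1 i|.
  rewrite ltNge; apply/negP => hb; apply: (tgood i); exists m.
  by rewrite -mE.
have g2 : side L k / 8 < `|tnth x i - (tnth (descend L k (grid_root t) x).1 i + side L k)|.
  rewrite ltNge; apply/negP => hb; apply: (tgood i); exists m.+1.
  by move: hb; rewrite mE -addrA -[X in _ + (_ + X)]mul1r -mulrDl natr1.
rewrite ger0_norm ?subr_ge0// in g1; rewrite ltr0_norm ?subr_lt0// in g2.
have := hy i; rewrite ler_norml => /andP[h3 h4]; apply/andP; split; lra.
Qed.

Let delta := side L 1 / 8.

Let deltaE : delta = 3 / 8 * rho.
Proof. by rewrite /delta /side /L expr1; field. Qed.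

Let delta0 : 0 < delta. Proof. by rewrite deltaE mulr_gt0// divr_gt0. Qed.

Let delta_side j : delta / 2 ^+ j = side L j.+1 / 8.
Proof. by rewrite /delta /side expr1 exprS; field; rewrite expf_neq0. Qed.

Definition near_region (x : E) : set E := [set y | l2dist x y <= 3 / 8 * rho].

Definition pot_kernel (beta : R) (x y : E) : R := (l2dist x y `^ beta)^-1.

Lemma measurable_l2dist_le (x : E) c : measurable [set y : E | l2dist x y <= c].
Proof.
rewrite -[X in measurable X]setTI.
have -> : [set y : E | l2dist x y <= c] = l2dist x @^-1` `]-oo, c]%classic.
  by apply/seteqP; split => y /=; rewrite in_itv.
by apply: measurable_l2dist2 => //; exact: measurable_itv.
Qed.

Lemma kernel_nonneg_meas beta x : nonneg_meas (pot_kernel beta x).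
Proof.
split => [y|]; first by rewrite invr_ge0 powR_ge0.
rewrite (_ : pot_kernel beta x = (fun t => t `^ (- beta)) \o l2dist x).
  by apply: (measurableT_comp (measurable_powR _)); exact: measurable_l2dist2.
by apply/funext => y; rewrite /pot_kernel /= powRN.
Qed.

Lemma kernel_gt0 beta x y : 0 < beta -> 0 < pot_kernel beta x y -> 0 < l2dist x y.
Proof.
move=> b0 k0; rewrite lt_neqAle l2dist_ge0 andbT eq_sym; apply/eqP => d0.
by move: k0; rewrite /pot_kernel d0 powR0 ?gt_eqF// invr0 ltxx.
Qed.

Lemma kernel_le beta x y c : 0 < beta -> 0 < c -> c <= l2dist x y ->
  pot_kernel beta x y <= c `^ (- beta).
Proof.
move=> b0 c0 cd; rewrite /pot_kernel powRN lef_pV2 ?posrE ?powR_gt0//; last exact: lt_le_trans cd.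
by rewrite ge0_ler_powR ?nnegrE ?(ltW b0) ?(ltW c0) ?l2dist_ge0.
Qed.

Variables (h : E -> R) (beta : R).
Hypotheses (hh : nonneg_meas h) (beta0 : 0 < beta).
Local Open Scope ereal_scope.

Lemma near_le x : eball x0 rho x ->
  \int[lambda]_(y in near_region x) (h y * pot_kernel beta x y)%:E <=
  \sum_(j <oo) ((side L j.+1 / 16) `^ (- beta))%:E *
    (\sum_t wmeasure h (ncell L (descend L j.+1 (grid_root t) x))).
Proof.
move=> hx.
have cov : \int[lambda]_(y in near_region x) (h y * pot_kernel beta x y)%:E <=
    \sum_(j <oo) ((side L j.+1 / 16) `^ (- beta))%:E *
      \int[lambda]_(y in [set y | (l2dist x y <= delta / 2 ^+ j)%R]) (h y)%:E.
  apply: (integral_cover_le lambda hh (kernel_nonneg_meas beta x)).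
  - exact: measurable_l2dist_le.
  - by move=> j; exact: measurable_l2dist_le.
  - by move=> j; exact: powR_ge0.
  move=> y hy ky; have d0 := kernel_gt0 beta0 ky.
  rewrite /near_region /= -deltaE in hy.
  have [j /andP[h1 h2]] := near_scale d0 hy.
  exists j => //; rewrite (_ : (side L j.+1 / 16 = delta / 2 ^+ j.+1)%R).
    by apply: kernel_le => //; [rewrite divr_gt0 ?exprn_gt0|exact: ltW].
  by rewrite exprS invfM mulrCA delta_side; field.
apply: (le_trans cov); apply: lee_nneseries => [j _|j _].
  by rewrite mule_ge0 ?lee_fin ?powR_ge0// integral_ge0// => y _; rewrite lee_fin hh.1.
apply: lee_wpmul2l; first by rewrite lee_fin powR_ge0.
have [t ht] := window j.+1 hx.
rewrite (bigD1 t)//=; apply: (@le_trans _ _ (wmeasure h (ncell L (descend L j.+1 (grid_root t) x)))).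
  apply: (le_wmeasure lambda hh); [exact: measurable_l2dist_le|exact: measurable_cell|].
  move=> y /= hy; apply: ht => i.
  by rewrite -delta_side; exact: le_trans (coord_le_l2dist _ _ _) hy.
by rewrite leeDl// sume_ge0// => t' _; exact: (wmeasure_ge0 lambda _ hh).
Qed.

Definition center_cube (s : R) : set E :=
  cube ([tuple (tnth x0 i - s)%R | i < n] : E) (2 * s).

Lemma far_le x : eball x0 rho x ->
  \int[lambda]_(y in ~` near_region x) (h y * pot_kernel beta x y)%:E <=
  \sum_(m <oo) ((3 / 8 * rho * 2 ^+ m) `^ (- beta))%:E *
    wmeasure h (center_cube (2 * rho * 2 ^+ m)).
Proof.
move=> hx.
apply: (integral_cover_le lambda hh (kernel_nonneg_meas beta x)).
- by apply: measurableC; exact: measurable_l2dist_le.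
- by move=> j; exact: measurable_cube.
- by move=> j; exact: powR_ge0.
move=> y /= /negP; rewrite /near_region -ltNge -deltaE => hy _.
have [m /andP[h1 h2]] := far_scale delta0 hy.
exists m; last by apply: kernel_le; rewrite ?mulr_gt0 ?exprn_gt0//; exact: ltW.
move=> i; have := ball_coord i hx; rewrite tnth_mktuple ltr_norml => /andP[h3 h4].
have := le_trans (coord_le_l2dist x y i) h2; rewrite deltaE ler_norml => /andP[h5 h6].
have h7 : (1 <= 2 ^+ m :> R)%R by rewrite exprn_ege1 ?ler1n.
have h8 : (rho <= rho * 2 ^+ m)%R by rewrite ler_peMr// ltW.
rewrite exprS in h5 h6; have h9 := rho0.
by apply/andP; split; lra.
Qed.

End local.

(** * The two weights *)

Section weights.
Context {R : realType} {n : nat}.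
Local Notation E := (Rn R n).
Local Notation lambda := (@lebesgue R n).
Variables (alpha p p' r C : R) (u v : E -> R).
Hypotheses (alpha0 : 0 < alpha) (alphan : alpha < n%:R).
Hypotheses (p1 : 1 < p) (pp' : p^-1 + p'^-1 = 1) (r1 : 1 < r) (C0 : 0 < C).
Hypotheses (hu : nonneg_meas u) (hv : nonneg_meas v).
Hypothesis ufin : forall x rho, (wmeasure u (eball x rho) < +oo)%E.
Hypothesis upos : forall x rho, 0 < rho -> (0 < wmeasure u (eball x rho))%E.
Hypothesis hb : forall (a : E) (l : R), 0 < l ->
  ((l ^+ n)%:E `^ (alpha / n%:R) *
   ((l ^+ n)%:E^-1 * \int[lambda]_(x in cube a l) (u x `^ r)%:E) `^ (r * p)^-1 *
   ((l ^+ n)%:E^-1 * \int[lambda]_(x in cube a l) (v x `^ (p' / p))%:E^-1) `^ p'^-1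
       <= C%:E)%E.

Let W (x : E) : R := u x `^ r.

Let hW : nonneg_meas W.
Proof.
split => [x|]; first exact: powR_ge0.
exact: (measurableT_comp (measurable_powR _) hu.2).
Qed.

Let n0 : 0 < n%:R :> R. Proof. exact: lt_trans alphan. Qed.

Let q01 : 0 < r^-1 < 1.
Proof. by rewrite invr_gt0 (lt_trans _ r1)//= invf_lt1// (lt_trans _ r1). Qed.

Lemma wmeasure_gt0_ball (x : E) rho A : 0 < rho -> measurable A ->
  eball x rho `<=` A -> (0 < wmeasure u A)%E.
Proof.
move=> rho0 mA sA; apply: (lt_le_trans (upos x rho0)).
by apply: (le_wmeasure lambda hu) => //; exact: measurable_eball.
Qed.

Lemma lebesgue_sub_cube A (a : E) l : 0 < l -> measurable A -> A `<=` cube a l ->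
  (lambda A <= (l ^+ n)%:E)%E.
Proof.
move=> l0 mA sA; rewrite -(lebesgue_cube a l0).
by apply: le_measure; rewrite ?inE//; exact: measurable_cube.
Qed.

Section on_cube.
Variables (a : E) (l : R) (A : set E).
Hypotheses (l0 : 0 < l) (mA : measurable A) (AQ : A `<=` cube a l).
Hypothesis A0 : (0 < wmeasure u A)%E.

Lemma W_gt0 : (0 < wmeasure W A)%E.
Proof.
have := hoelder_gmean r1 mA hu.2 hu.1 (lebesgue_sub_cube l0 mA AQ).
rewrite lt0e (wmeasure_ge0 lambda _ hW) andbT => H; apply/eqP => W0.
move: A0; rewrite ltNge => /negP; apply; apply: (le_trans H).
rewrite -/(wmeasure W A) W0 poweR0r ?mule0// invr_eq0 gt_eqF//.
exact: lt_trans r1.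
Qed.

Lemma W_fin : (wmeasure W A < +oo)%E.
Proof.
have [h1 [h2 h3]] := bump_finite p1 pp' r1 hu.2 hv.2 hv.1 mA (measurable_cube a l) AQ
   (exprn_gt0 n l0) (lebesgue_cube a l0) (hb a l0) W_gt0.
exact: le_lt_trans h2.
Qed.

Lemma mass_W_gt0 : 0 < mass W A.
Proof. by rewrite fine_gt0// W_gt0 W_fin. Qed.

Lemma u_fin : (wmeasure u A < +oo)%E.
Proof.
apply: le_lt_trans (hoelder_gmean r1 mA hu.2 hu.1 (lebesgue_sub_cube l0 mA AQ)) _.
rewrite -/(wmeasure W A) -[wmeasure W A]fineK; last first.
  by rewrite ge0_fin_numE ?W_fin// (wmeasure_ge0 lambda _ hW).
by rewrite !poweR_EFin -EFinM ltry.
Qed.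

Lemma mass_u_le : mass u A <= gmean r^-1 (l ^+ n) (mass W A).
Proof.
have := hoelder_gmean r1 mA hu.2 hu.1 (lebesgue_sub_cube l0 mA AQ).
rewrite -/(wmeasure W A) -/(wmeasure u A).
have /fineK <- : wmeasure W A \is a fin_num.
  by rewrite ge0_fin_numE ?W_fin// (wmeasure_ge0 lambda _ hW).
have /fineK <- : wmeasure u A \is a fin_num.
  by rewrite ge0_fin_numE ?u_fin// (wmeasure_ge0 lambda _ hu).
by rewrite !poweR_EFin -EFinM lee_fin.
Qed.

Lemma cube_ratio (h : E -> R) : nonneg_meas h ->
  (wmeasure (fun x => h x `^ p * v x)%R A < +oo)%E ->
  (wmeasure h A < +oo)%E /\
  l `^ alpha * (mass h A / l ^+ n) <=
  C * (mass (fun x => h x `^ p * v x) A / gmean r^-1 (l ^+ n) (mass W A)) `^ p^-1.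
Proof.
move=> hh phifin.
have := bump_ratio p1 pp' r1 hu.2 hv.2 hv.1 mA (measurable_cube a l) AQ
   (exprn_gt0 n l0) (lebesgue_cube a l0) (hb a l0) W_gt0 hh.2 hh.1 phifin.
rewrite (_ : (l ^+ n) `^ (alpha / n%:R) = l `^ alpha)//.
by rewrite -powR_mulrn ?(ltW l0)// -powRrM mulrCA mulfV ?mulr1// gt_eqF.
Qed.

End on_cube.

Definition phi (h : E -> R) (x : E) : R := h x `^ p * v x.

Lemma phi_nonneg_meas h : nonneg_meas h -> nonneg_meas (phi h).
Proof.
move=> [h0 mh]; split => [x|]; first by rewrite mulr_ge0 ?powR_ge0// hv.1.
apply: measurable_funM; last exact: hv.2.
exact: (measurableT_comp (measurable_powR _)).
Qed.

Definition phi_fin (h : E -> R) := forall x rho, 0 < rho ->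
  (wmeasure (phi h) (eball x rho) < +oo)%E.

Lemma phi_fin_sub h A (a : E) l : nonneg_meas h -> phi_fin h -> 0 < l ->
  measurable A -> A `<=` cube a l -> (wmeasure (phi h) A < +oo)%E.
Proof.
move=> hh hf l0 mA sA.
have b0 : 0 < n.+1%:R * l by rewrite mulr_gt0.
apply: le_lt_trans (hf a _ b0).
apply: (le_wmeasure lambda (phi_nonneg_meas hh)) => //; first exact: measurable_eball.
apply: (subset_trans sA); apply: (@subset_cube_eball _ _ _ _ l).
- exact: ltW.
- by rewrite ltr_pM2r// ltr_nat.
- by move=> i; split; lra.
Qed.

Section on_nodes.
Variables (L : R) (h : E -> R).
Hypotheses (L0 : 0 < L) (hh : nonneg_meas h) (hf : phi_fin h).

Lemma ncell_sub_cube (v' : @node R n) : ncell L v' `<=` cube v'.1 (side L v'.2).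
Proof. exact: subset_cell_cube. Qed.

Lemma ncell_gt0 (v' : @node R n) : (0 < wmeasure u (ncell L v'))%E.
Proof.
have s0 := side_gt0 L0 v'.2.
apply: (@wmeasure_gt0_ball ([tuple tnth v'.1 i + side L v'.2 / 2 | i < n] : E) (side L v'.2 / 2)).
- by rewrite divr_gt0.
- exact: measurable_cell.
- by apply: subset_eball_cube => i; rewrite tnth_mktuple; split; lra.
Qed.

Lemma ncell_phi_fin (v' : @node R n) : (wmeasure (phi h) (ncell L v') < +oo)%E.
Proof.
apply: (phi_fin_sub hh hf (side_gt0 L0 v'.2)); first exact: measurable_cell.
exact: ncell_sub_cube.
Qed.

Lemma ncell_ratio (v' : @node R n) : (wmeasure h (ncell L v') < +oo)%E /\
  side L v'.2 `^ alpha * (mass h (ncell L v') / side L v'.2 ^+ n) <=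
  C * (mass (phi h) (ncell L v') /
       gmean r^-1 (side L v'.2 ^+ n) (mass W (ncell L v'))) `^ p^-1.
Proof.
apply: cube_ratio => //.
- exact: side_gt0.
- exact: measurable_cell.
- exact: ncell_sub_cube.
- exact: ncell_gt0.
- exact: ncell_phi_fin.
Qed.

Lemma mass_child (g : E -> R) (v' : @node R n) : nonneg_meas g ->
  (forall v' : @node R n, (wmeasure g (ncell L v') < +oo)%E) ->
  \sum_e mass g (ncell L (nchild L v' e)) = mass g (ncell L v').
Proof.
move=> hg gf; rewrite /mass (wmeasure_ncell L0 v' hg) sum_fine// => e _.
by rewrite ge0_fin_numE// (wmeasure_ge0 lambda _ hg).
Qed.

End on_nodes.

Definition nodeval (L : R) (h : E -> R) (v' : @node R n) : R :=
  side L v'.2 `^ alpha * (mass h (ncell L v') / side L v'.2 ^+ n).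

Lemma excess_set_weak : exists2 Ct, 0 < Ct &
  forall L h, 0 < L -> nonneg_meas h -> phi_fin h ->
  forall N (v' : @node R n) t, 0 < t ->
  (wmeasure u (excess_set L (nodeval L h) N v' t) <=
   (Ct * (t `^ (- p) * mass (phi h) (ncell L v')))%:E)%E.
Proof.
have q2 : 0 < (2 : R) `^ (- alpha) < 1.
  rewrite powR_gt0//= powRN invf_lt1 ?powR_gt0//.
  have /(gt0_ltr_powR alpha0) : (1 : R) < 2 by rewrite ltr1n.
  by rewrite powR1; apply; rewrite nnegrE.
have [Ct Ct0 HC] := tree_weak_type p1 q01 q2 C0.
exists Ct => // L h L0 hh hf N v' t t0.
have ufinL w : (wmeasure u (ncell L w) < +oo)%E.
  exact: (u_fin (side_gt0 L0 w.2) (measurable_cell _ _) (@ncell_sub_cube L w) (ncell_gt0 L0 w)).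
have WfinL w : (wmeasure W (ncell L w) < +oo)%E.
  exact: (W_fin (side_gt0 L0 w.2) (measurable_cell _ _) (@ncell_sub_cube L w) (ncell_gt0 L0 w)).
have hfinL w : (wmeasure h (ncell L w) < +oo)%E by have [] := ncell_ratio L0 hh hf w.
have pfinL w : (wmeasure (phi h) (ncell L w) < +oo)%E by exact: ncell_phi_fin.
have mass0 (g : E -> R) (A : set E) : nonneg_meas g -> 0 <= mass g A.
  by move=> hg; apply: fine_ge0; exact: (wmeasure_ge0 lambda _ hg).
apply: (le_trans (@wmeasure_excess_set _ _ L L0 (nodeval L h) u
  (fun w => side L w.2 `^ alpha) (fun w => side L w.2 ^+ n)
  (fun w => mass h (ncell L w)) hu ufinL (fun=> erefl) N v' t)).
rewrite lee_fin; apply: (HC _ _ _ _ _ _ _ (fun w => mass W (ncell L w))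
  (fun w => mass (phi h) (ncell L w))) => //.
- by move=> w; exact: mass0.
- by move=> w; rewrite mass_child.
- by move=> w; rewrite exprn_gt0// side_gt0.
- move=> w; exact: (mass_W_gt0 (side_gt0 L0 w.2) (measurable_cell _ _) (@ncell_sub_cube L w) (ncell_gt0 L0 w)).
- by move=> w; exact: mass0.
- by move=> w; apply: mass0; exact: phi_nonneg_meas.
- by move=> w; rewrite powR_gt0// side_gt0.
- by move=> w; rewrite mass_child.
- by move=> w; rewrite mass_child.
- by move=> w; exact: (mass_child L0 w (phi_nonneg_meas hh) pfinL).
- move=> w e; rewrite /= [in RHS](sideS L w.2) powRM ?(ltW (side_gt0 L0 _))//.
  by rewrite mulrA -powRD ?addNr ?powRr0 ?mul1r// pnatr_eq0 implybT.
- move=> w; exact: (mass_u_le (side_gt0 L0 w.2) (measurable_cell _ _) (@ncell_sub_cube L w) (ncell_gt0 L0 w)).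
- by move=> w; have [] := ncell_ratio L0 hh hf w.
Qed.

Lemma nodeval_ge0 L h v' : 0 < L -> nonneg_meas h -> 0 <= nodeval L h v'.
Proof.
move=> L0 hh; rewrite mulr_ge0 ?powR_ge0// divr_ge0 ?exprn_ge0 ?(ltW (side_gt0 L0 _))//.
by apply: fine_ge0; exact: (wmeasure_ge0 lambda _ hh).
Qed.

Lemma excess_set_mono L h N v' t : 0 < L -> nonneg_meas h ->
  excess_set L (nodeval L h) N v' t `<=` excess_set L (nodeval L h) N.+1 v' t.
Proof.
move=> L0 hh x [vx tx]; split => //; rewrite big_ord_recr/=.
by apply: (lt_le_trans tx); rewrite lerDl nodeval_ge0.
Qed.

Lemma near_term L h (v' : @node R n) : 0 < L -> nonneg_meas h ->
  (wmeasure h (ncell L v') < +oo)%E ->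
  (((side L v'.2 / 16) `^ (- (n%:R - alpha)))%:E * wmeasure h (ncell L v') =
   (16 `^ (n%:R - alpha) * nodeval L h v')%:E)%E.
Proof.
move=> L0 hh hf; have s0 := side_gt0 L0 v'.2.
have /fineK <- : wmeasure h (ncell L v') \is a fin_num.
  by rewrite ge0_fin_numE// (wmeasure_ge0 lambda _ hh).
rewrite -EFinM; congr EFin; rewrite -/(mass _ _) /nodeval.
rewrite powRM ?invr_ge0 ?(ltW s0)// powRV// [X in X^-1]powRN invrK.
rewrite opprB powRB; last by rewrite (gt_eqF s0) implybT.
by rewrite powR_mulrn ?(ltW s0)//; ring.
Qed.

Lemma root_sub_ball (x0 : E) rho t : 0 < rho ->
  ncell (6 * rho) (grid_root x0 rho t) `<=` eball x0 (2 ^+ (4 * n) * rho).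
Proof.
move=> rho0; apply: (subset_trans (@ncell_sub_cube _ _)).
apply: (@subset_cube_eball _ _ _ _ (4 * rho)).
- by rewrite mulr_ge0// ltW.
(* A power of 2 beyond 4 n, so that doubling can be iterated. *)
- rewrite mulrCA mulrA ltr_pM2r// -natrM -natrX ltr_nat; exact: ltn_expl.
- move=> i; rewrite /= tnth_mktuple /side expr0 divr1.
  by case: ifP => _; split; lra.
Qed.

(** The point x is in [G] as soon as, on one grid and at some finite depth, the
dyadic sum exceeds its share of tau; finite depths increase to the full sum. *)
Lemma near_weak : exists2 Cn, 0 < Cn & forall (h : E -> R) (x0 : E) (rho tau : R),
  nonneg_meas h -> phi_fin h -> 0 < rho -> 0 < tau ->
  exists G : set E, [/\ measurable G,
    (forall x, eball x0 rho x ->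
      (tau%:E < \int[lambda]_(y in near_region rho x)
                  (h y * pot_kernel (n%:R - alpha) x y)%:E)%E -> G x) &
    (wmeasure u G <=
      (Cn * (tau `^ (- p) * mass (phi h) (eball x0 (2 ^+ (4 * n) * rho))))%:E)%E].
Proof.
have [Ct Ct0 HC] := excess_set_weak.
have beta0 : 0 < n%:R - alpha by rewrite subr_gt0.
pose T : R := #|{ffun 'I_n -> bool}|%:R.
have T0 : 0 < T by rewrite ltr0n card_ffun card_bool expn_gt0.
pose k : R := 16 `^ (n%:R - alpha) * T.
have k0 : 0 < k by rewrite mulr_gt0// powR_gt0.
(* Each of the T grids gets the share tau / k of the height. *)
exists (T * Ct * k `^ p); first by rewrite !mulr_gt0// powR_gt0.
move=> h x0 rho tau hh hf rho0 tau0.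
have L0 : 0 < 6 * rho by rewrite mulr_gt0.
set L := 6 * rho in L0 *.
have B0 : 0 < 2 ^+ (4 * n) * rho by rewrite mulr_gt0// exprn_gt0.
set B := eball x0 (_ * rho).
have tau'0 : 0 < tau / k by rewrite divr_gt0.
pose U j t := excess_set L (nodeval L h) j (grid_root x0 rho t) (tau / k).
have mU j t : measurable (U j t) by exact: measurable_excess_set.
pose F j := \bigcup_(t in [set: {ffun 'I_n -> bool}]) U j t.
have mF j : measurable (F j) by apply: fin_bigcup_measurable => // t _; exact: mU.
have hfin (w : @node R n) : (wmeasure h (ncell L w) < +oo)%E.
  by have [] := ncell_ratio L0 hh hf w.
exists (\bigcup_j F j); split; first exact: bigcupT_measurable.
  move=> x hx; apply: contraPP => nG; apply/negP; rewrite -leNgt.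
  have small j t : \sum_(i < j) nodeval L h (descend L i.+1 (grid_root x0 rho t) x) <= tau / k.
    rewrite leNgt; apply/negP => big; apply: nG; exists j => //; exists t => //.
    by split => //; exact: ball_sub_root.
  apply: (le_trans (near_le rho0 hh beta0 hx)).
  have e0 j : (0 <= ((side L j.+1 / 16) `^ (- (n%:R - alpha)))%:E *
     (\sum_t wmeasure h (ncell L (descend L j.+1 (grid_root x0 rho t) x))))%E.
    rewrite mule_ge0 ?lee_fin ?powR_ge0// sume_ge0// => t _.
    exact: (wmeasure_ge0 lambda _ hh).
  apply: lime_le; first by apply: is_cvg_nneseries => j _ _; exact: e0.
  apply: nearW => N; rewrite big_mkord.
  rewrite (eq_bigr (fun j : 'I_N => (16 `^ (n%:R - alpha) *
      \sum_t nodeval L h (descend L j.+1 (grid_root x0 rho t) x))%:E)); last first.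
    move=> j _; rewrite ge0_sume_distrr; last first.
      by move=> t _; exact: (wmeasure_ge0 lambda _ hh).
    rewrite mulr_sumr -sumEFin; apply: eq_bigr => t _.
    have := near_term L0 hh (hfin (descend L j.+1 (grid_root x0 rho t) x)).
    by rewrite descend_level.
  rewrite sumEFin lee_fin -mulr_sumr exchange_big/=.
  apply: (@le_trans _ _ (16 `^ (n%:R - alpha) * \sum_(t : {ffun 'I_n -> bool}) (tau / k))).
    rewrite ler_wpM2l ?powR_ge0//; apply: ler_sum => t _; exact: small.
  rewrite sumr_const -[X in _ * X]mulr_natr -/T le_eqVlt; apply/orP; left; apply/eqP.
  have w0 : 0 < (16 : R) `^ (n%:R - alpha) by rewrite powR_gt0.
  by rewrite /k; field; rewrite !gt_eqF.
have step j : (wmeasure u (F j) <=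
    (T * Ct * k `^ p * (tau `^ (- p) * mass (phi h) B))%:E)%E.
  apply: (le_trans (wmeasure_union_le lambda hu (mU j) (mF j) _)).
    by move=> x [t _ ?]; exists t.
  apply: (@le_trans _ _ (\sum_(t : {ffun 'I_n -> bool})
      (Ct * ((tau / k) `^ (- p) * mass (phi h) B))%:E)%E).
    apply: lee_sum => t _; apply: (le_trans (HC L h L0 hh hf j _ _ tau'0)).
    rewrite lee_fin ler_pM2l// ler_wpM2l ?powR_ge0//.
    apply: fine_le.
    - rewrite ge0_fin_numE; first exact: ncell_phi_fin.
      exact: (wmeasure_ge0 lambda _ (phi_nonneg_meas hh)).
    - rewrite ge0_fin_numE; first exact: (hf x0 _ B0).
      exact: (wmeasure_ge0 lambda _ (phi_nonneg_meas hh)).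
    apply: (le_wmeasure lambda (phi_nonneg_meas hh)).
    - exact: measurable_cell.
    - exact: measurable_eball.
    - exact: root_sub_ball.
  rewrite sumEFin lee_fin sumr_const -[leLHS]mulr_natl -/T.
  rewrite powRM ?invr_ge0 ?(ltW tau0) ?(ltW k0)// powRV ?(ltW k0)// [X in _ / X]powRN invrK.
  by rewrite le_eqVlt; apply/orP; left; apply/eqP; ring.
have ndF j : F j `<=` F j.+1.
  by move=> x [t _ Ut]; exists t => //; exact: excess_set_mono.
exact: (integral_bigcup_nd_le hu mF ndF step).
Qed.

Section far.
Variables (theta : R -> R) (kappa Cd Ck : R).
Hypotheses (k01 : 0 <= kappa < 1) (Cd0 : 0 <= Cd) (Ck1 : 1 <= Ck).
Hypothesis doubling : forall x rho, 0 < rho ->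
  (wmeasure u (eball x (2 * rho)) <= Cd%:E * wmeasure u (eball x rho))%E.
Hypothesis theta0 : forall xi, 0 < xi -> 0 < theta xi.
Hypothesis theta_grow : forall xi' xi, 0 < xi' -> xi' <= xi ->
  theta xi <= Ck * theta xi' * (xi / xi') `^ kappa.

Lemma mass_uball_gt0 (x : E) rho : 0 < rho -> 0 < mass u (eball x rho).
Proof. by move=> rho0; rewrite fine_gt0// upos// ufin. Qed.

Lemma fin_uball (x : E) rho : wmeasure u (eball x rho) = (mass u (eball x rho))%:E.
Proof.
by rewrite fineK// ge0_fin_numE ?ufin// (wmeasure_ge0 lambda _ hu).
Qed.

Lemma doubling_iter (x : E) rho m : 0 < rho ->
  mass u (eball x (2 ^+ m * rho)) <= Cd ^+ m * mass u (eball x rho).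
Proof.
move=> rho0; elim: m => [|m IH]; first by rewrite !expr0 !mul1r.
have m0 : 0 < 2 ^+ m * rho by rewrite mulr_gt0// exprn_gt0.
have := doubling x m0; rewrite !fin_uball -EFinM lee_fin => h1.
rewrite exprS -mulrA; apply: (le_trans h1); rewrite exprS -mulrA.
exact: ler_wpM2l.
Qed.

Lemma mass_le_fin (g : E -> R) (A B : set E) : nonneg_meas g -> measurable A ->
  measurable B -> A `<=` B -> (wmeasure g B < +oo)%E -> mass g A <= mass g B.
Proof.
move=> hg mA mB AB gB; have AB' := le_wmeasure lambda hg mA mB AB.
apply: fine_le => //.
- rewrite ge0_fin_numE; first exact: le_lt_trans gB.
  exact: (wmeasure_ge0 lambda _ hg).
- by rewrite ge0_fin_numE//; exact: (wmeasure_ge0 lambda _ hg).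
Qed.

Lemma theta_ball (x : E) rho m : 0 < rho ->
  theta (mass u (eball x (2 ^+ m * rho))) <=
  Ck * (Cd ^+ m) `^ kappa * theta (mass u (eball x rho)).
Proof.
move=> rho0; have U0 := mass_uball_gt0 x rho0.
have /andP[k0 k1] := k01.
have m0 : 0 < 2 ^+ m * rho by rewrite mulr_gt0// exprn_gt0.
have rle : rho <= 2 ^+ m * rho by rewrite ler_peMl ?(ltW rho0)// exprn_ege1// ler1n.
have Ule : mass u (eball x rho) <= mass u (eball x (2 ^+ m * rho)).
  apply: (mass_le_fin hu) => //; [exact: measurable_eball|exact: measurable_eball|].
  by move=> y /= h; exact: lt_le_trans rle.
apply: (le_trans (theta_grow U0 Ule)).
rewrite -!mulrA ler_wpM2l ?(le_trans ler01 Ck1)// mulrC ler_wpM2r ?(ltW (theta0 U0))//.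
apply: ge0_ler_powR => //; rewrite ?nnegrE.
- by rewrite divr_ge0 ?(ltW U0)// ltW// mass_uball_gt0.
- by rewrite exprn_ge0.
- by rewrite ler_pdivrMr//; exact: doubling_iter.
Qed.

Lemma center_cube_in_ball (x0 : E) s : 0 < s ->
  center_cube x0 (2 * s) `<=` eball x0 (2 ^+ (4 * n) * s).
Proof.
move=> s0; apply: (@subset_cube_eball _ _ _ _ (4 * s)).
- by rewrite mulr_ge0// ltW.
- rewrite mulrCA mulrA ltr_pM2r// -natrM -natrX ltr_nat; exact: ltn_expl.
- by move=> i; rewrite tnth_mktuple; split; lra.
Qed.

Lemma ball_in_center_cube (x0 : E) s : 0 < s ->
  eball x0 s `<=` center_cube x0 (2 * s).
Proof.
move=> s0; apply: subset_trans (@subset_cell_cube _ _ _ _).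
by apply: subset_eball_cube => i; rewrite tnth_mktuple; split; lra.
Qed.

(** The m-th cube has side 4 s with s = 2^m rho; it contains the ball of radius s
and lies in the ball of radius 2^(4n) s, so doubling compares u on that ball with
[gmean] on the cube. *)
Lemma far_strong : exists2 Cf, 0 < Cf & forall (h : E -> R) (M : R) (x0 : E) (rho : R),
  nonneg_meas h -> phi_fin h -> 0 <= M ->
  (forall x s, 0 < s ->
     mass (phi h) (eball x s) <= theta (mass u (eball x s)) * M `^ p) ->
  0 < rho -> forall x, eball x0 rho x ->
  (\int[lambda]_(y in ~` near_region rho x)
      (h y * pot_kernel (n%:R - alpha) x y)%:E <=
   (Cf * M * (theta (mass u (eball x0 rho)) / mass u (eball x0 rho)) `^ p^-1)%:E)%E.
Proof.
have beta0 : 0 < n%:R - alpha by rewrite subr_gt0.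
have /andP[k0 k1] := k01; have /andP[q0 q1] := q01.
have p0 : 0 < p by exact: lt_trans p1.
pose G : R := ((2 ^+ n) `^ (1 - r^-1))^-1.
have G0 : 0 < G by rewrite invr_gt0 powR_gt0// exprn_gt0.
have n1 : (0 < n)%N by rewrite -(ltr_nat R).
have G1 : G < 1.
  rewrite /G invf_lt1 ?powR_gt0 ?exprn_gt0//.
  have : (1 : R) < 2 ^+ n by rewrite exprn_egt1 ?ltr1n// -lt0n.
  have q' : 0 < 1 - r^-1 by rewrite subr_gt0.
  move=> /(gt0_ltr_powR q'); rewrite powR1; apply; rewrite nnegrE ?exprn_ge0 ?ler01//.
pose g := G `^ ((1 - kappa) / p).
have e0 : 0 < (1 - kappa) / p by rewrite divr_gt0// subr_gt0.
have g01 : 0 <= g < 1.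
  rewrite powR_ge0/=.
  move: G1 => /(gt0_ltr_powR e0); rewrite powR1; apply; rewrite nnegrE ?exprn_ge0 ?ler01//.
  exact: ltW.
pose K : R := (3 / 32) `^ (- (n%:R - alpha)) * C.
have K0 : 0 < K by rewrite mulr_gt0// powR_gt0// divr_gt0.
pose Cq := Cd ^+ (4 * n).
have Cq0 : 0 <= Cq by rewrite exprn_ge0.
pose b : R := (Ck * Cq `^ kappa) `^ p^-1.
have b0 : 0 <= b by exact: powR_ge0.
exists ((K * b + 1) / (1 - g)).
  have /andP[_ g1] := g01.
  by rewrite divr_gt0 ?subr_gt0// ltr_wpDl// mulr_ge0// ltW.
move=> h M x0 rho hh hf M0 hM rho0 x hx.
apply: (le_trans (far_le rho0 hh beta0 hx)).
set U := mass u (eball x0 rho); set th := theta U.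
have U0 : 0 < U by exact: mass_uball_gt0.
have th0 : 0 < th by exact: theta0.
have t0 : 0 <= (th / U) `^ p^-1 by exact: powR_ge0.
apply: (@le_trans _ _ (\sum_(m <oo) (K * (b * M * (th / U) `^ p^-1) * g ^+ m)%:E)%E).
  apply: lee_nneseries => [m _|m _].
    by rewrite mule_ge0 ?lee_fin ?powR_ge0//; exact: (wmeasure_ge0 lambda _ hh).
  have s0 : 0 < rho * 2 ^+ m by rewrite mulr_gt0// exprn_gt0.
  rewrite -!(mulrA _ rho).
  set s := rho * 2 ^+ m in s0 *.
  have l0 : 0 < 2 * (2 * s) by rewrite !mulr_gt0.
  set Q := center_cube x0 (2 * s).
  have mQ : measurable Q by exact: measurable_cube.
  have Q0 : (0 < wmeasure u Q)%E.
    by apply: (wmeasure_gt0_ball s0 mQ); exact: ball_in_center_cube.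
  have QQ : Q `<=` Q by [].
  have pQ := phi_fin_sub hh hf l0 mQ QQ.
  have [hfin hle] := cube_ratio l0 mQ QQ Q0 hh pQ.
  have WQ0 := mass_W_gt0 l0 mQ QQ Q0.
  have WQoo := W_fin l0 mQ QQ Q0.
  have uQ := mass_u_le l0 mQ QQ Q0.
  have uQoo := u_fin l0 mQ QQ Q0.
  set D := gmean r^-1 _ _ in hle uQ.
  have D0 : 0 < D by rewrite gmean_gt0// exprn_gt0.
  have hD : mass u (eball x0 s) <= D.
    apply: le_trans uQ; apply: (mass_le_fin hu _ mQ _ uQoo).
      exact: measurable_eball.
    exact: ball_in_center_cube.
  have /fineK <- : wmeasure h Q \is a fin_num.
    by rewrite ge0_fin_numE//; exact: (wmeasure_ge0 lambda _ hh).
  rewrite -/(mass h Q) -EFinM lee_fin.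
  have lE : 3 / 8 * s = 3 / 32 * (2 * (2 * s)) by field.
  have l32 : (0 : R) <= 3 / 32 by rewrite divr_ge0.
  rewrite lE (powRM _ l32 (ltW l0)).
  have hle' : (2 * (2 * s)) `^ (- (n%:R - alpha)) * mass h Q <=
      C * (mass (phi h) Q / D) `^ p^-1.
    apply: le_trans hle; rewrite opprB powRB; last by rewrite (gt_eqF l0) implybT.
    rewrite powR_mulrn ?(ltW l0)//.
    by rewrite le_eqVlt; apply/orP; left; apply/eqP; field; rewrite expf_neq0// gt_eqF.
  rewrite -mulrA /K -!mulrA ler_pM2l; last by rewrite powR_gt0// divr_gt0.
  apply: (le_trans hle'); rewrite ler_pM2l// !mulrA.
  apply: far_real => //.
  - exact: le_trans Ck1.
  - exact: ltW.
  - by apply: fine_ge0; exact: (wmeasure_ge0 lambda _ (phi_nonneg_meas hh)).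
  - have r0 : 0 < 2 * (2 * rho) by rewrite !mulr_gt0.
    set Q' := center_cube x0 (2 * rho).
    have mQ' : measurable Q' by exact: measurable_cube.
    have BQ' : eball x0 rho `<=` Q' by exact: ball_in_center_cube.
    have Q'0 : (0 < wmeasure u Q')%E by exact: (wmeasure_gt0_ball rho0 mQ' BQ').
    have QQ' : Q' `<=` Q' by [].
    have Q'Q : Q' `<=` Q.
      have rs : rho <= s by rewrite /s ler_peMr ?(ltW rho0)// exprn_ege1// ler1n.
      by apply: subset_cube => i; rewrite !tnth_mktuple; split; lra.
    have UQ' : U <= gmean r^-1 ((2 * (2 * rho)) ^+ n) (mass W Q').
      apply: le_trans (mass_u_le r0 mQ' QQ' Q'0).
      apply: (mass_le_fin hu _ mQ' BQ' (u_fin r0 mQ' QQ' Q'0)).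
      exact: measurable_eball.
    have WW : mass W Q' <= mass W Q by exact: mass_le_fin.
    apply: (le_trans UQ').
    apply: (@le_trans _ _ (gmean r^-1 ((2 * (2 * rho)) ^+ n) (mass W Q))).
      apply: ler_gmean => //; first by rewrite exprn_ge0// ltW.
      by apply: fine_ge0; exact: (wmeasure_ge0 lambda _ hW).
    rewrite /D (_ : (2 * (2 * s)) ^+ n = (2 ^+ n) ^+ m * (2 * (2 * rho)) ^+ n); last first.
      by rewrite /s !exprMn [(2 ^+ n) ^+ m]exprAC; ring.
    rewrite /gmean [in leRHS]powRM ?exprn_ge0 ?(ltW r0)//.
    rewrite -[((2 ^+ n) ^+ m)]powR_mulrn ?exprn_ge0// powRAC powR_mulrn ?powR_ge0//.
    have : 0 < (2 ^+ n : R) `^ (1 - r^-1) by rewrite powR_gt0// exprn_gt0.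
    rewrite /G; move: ((2 ^+ n : R) `^ (1 - r^-1)) => X X0.
    move: (_ `^ (1 - r^-1)) (mass W Q `^ _) => Y Z.
    by rewrite mulrA mulrA -exprMn mulVf ?gt_eqF// expr1n mul1r.
  - have s'0 : 0 < 2 ^+ (4 * n) * s by rewrite mulr_gt0// exprn_gt0.
    apply: (@le_trans _ _ (mass (phi h) (eball x0 (2 ^+ (4 * n) * s)))).
      apply: (mass_le_fin (phi_nonneg_meas hh) mQ _ _ (hf _ _ s'0)).
        exact: measurable_eball.
      exact: center_cube_in_ball.
    apply: (le_trans (hM _ _ s'0)); rewrite ler_wpM2r ?powR_ge0//.
    have Ule : U <= mass u (eball x0 (2 ^+ (4 * n) * s)).
      apply: (mass_le_fin hu) => //; [exact: measurable_eball|exact: measurable_eball|].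
      move=> y /= hy; apply: (lt_le_trans hy).
      by rewrite /s mulrCA ler_peMr ?(ltW rho0)// -exprD exprn_ege1// ler1n.
    apply: (le_trans (theta_grow U0 Ule)).
    rewrite ler_wpM2l ?mulr_ge0 ?(ltW th0) ?(le_trans ler01 Ck1)//.
    apply: ge0_ler_powR => //; rewrite ?nnegrE.
    + by rewrite divr_ge0 ?(ltW U0)// ltW// mass_uball_gt0.
    + by rewrite divr_ge0 ?(ltW U0)// mulr_ge0// ltW.
    rewrite ler_pM2r ?invr_gt0//; apply: (le_trans (doubling_iter _ _ s0)).
    by rewrite ler_wpM2l.
have B0 : 0 <= b * M * (th / U) `^ p^-1 by rewrite !mulr_ge0.
apply: (le_trans (geometric_series_le _ g01)); first by rewrite mulr_ge0// ltW.
have /andP[_ g1] := g01; have g1' : 0 < 1 - g by rewrite subr_gt0.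
rewrite lee_fin; move: (_ `^ p^-1) t0 => Y Y0.
rewrite (_ : K * (b * M * Y) / (1 - g) = K * b / (1 - g) * (M * Y)); last by ring.
rewrite -[leRHS]mulrA ler_wpM2r ?mulr_ge0//.
by rewrite ler_pM2r ?invr_gt0// lerDl ler01.
Qed.

(** If sigma is comparable with the bound for the far part, the trivial estimate
by u(B) suffices; otherwise the near part exceeds a multiple of sigma on the whole
level set. *)
Lemma weak_estimate : exists2 C', 0 < C' & forall (f : E -> R) (M : R) (x0 : E) (rho sigma : R),
  measurable_fun setT f -> phi_fin (fun y => `|f y|) -> 0 <= M ->
  (forall x s, 0 < s ->
     mass (phi (fun y => `|f y|)) (eball x s) <= theta (mass u (eball x s)) * M `^ p) ->
  0 < rho -> 0 < sigma ->
  sigma * (mass u [set y | eball x0 rho y /\ (sigma%:E < `|riesz alpha f y|)%E]) `^ p^-1 <=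
  C' * M * theta (mass u (eball x0 rho)) `^ p^-1.
Proof.
have [Cn Cn0 near_w] := near_weak.
have [Cf Cf0 far_s] := far_strong.
have p0 : 0 < p by exact: lt_trans p1.
have p'0 : 0 <= p^-1 by rewrite invr_ge0 ltW.
have /andP[k0 k1] := k01.
pose c : R := `|(@riesz_gamma R n alpha)^-1| + 1.
have c0 : 0 < c by rewrite ltr_wpDl.
pose Cm : R := Ck * (Cd ^+ (4 * n)) `^ kappa.
have Cm0 : 0 <= Cm by rewrite mulr_ge0 ?powR_ge0// (le_trans ler01 Ck1).
exists (2 * c * (Cf + (Cn * Cm) `^ p^-1)).
  by rewrite !mulr_gt0// ltr_pwDl// powR_ge0.
move=> f M x0 rho sigma mf hf M0 hM rho0 sigma0.
pose h (y : E) := `|f y|.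
have hh : nonneg_meas h.
  split; first by move=> y; exact: normr_ge0.
  exact: (measurableT_comp (@normr_measurable _ _) mf).
set A := [set y | _].
set U := mass u (eball x0 rho); set th := theta U.
have U0 : 0 < U by exact: mass_uball_gt0.
have th0 : 0 < th by exact: theta0.
have AB : A `<=` eball x0 rho by move=> y [].
have mS := measurable_riesz_level alpha sigma mf.
have mA : measurable A by exact: measurableI (measurable_eball x0 rho) mS.
have mAU : mass u A <= U.
  by apply: (mass_le_fin hu mA _ AB (ufin _ _)); exact: measurable_eball.
have mA0 : 0 <= mass u A by apply: fine_ge0; exact: (wmeasure_ge0 lambda _ hu).
pose I1 x := (\int[lambda]_(y in near_region rho x) (h y * pot_kernel (n%:R - alpha) x y)%:E)%E.
pose I2 x := (\int[lambda]_(y in ~` near_region rho x) (h y * pot_kernel (n%:R - alpha) x y)%:E)%E.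
have rle x : (`|riesz alpha f x| <= c%:E * (I1 x + I2 x))%E.
  rewrite /riesz abseM; apply: lee_pmul; [exact: abse_ge0|exact: abse_ge0| |].
    by rewrite lee_fin lerDl.
  have hk := kernel_nonneg_meas (n%:R - alpha) x.
  apply: (le_trans (abse_integral_le lambda mf hk)).
  have hp : nonneg_meas (fun y => h y * pot_kernel (n%:R - alpha) x y).
    split; first by move=> y; apply: mulr_ge0; [exact: hh.1|exact: hk.1].
    exact: (measurable_funM hh.2 hk.2).
  have E12 := integral_split lambda hp (measurable_l2dist_le x (3 / 8 * rho)).
  by rewrite le_eqVlt E12 eqxx.
pose Lam := Cf * M * (th / U) `^ p^-1.
have I2le x : eball x0 rho x -> (I2 x <= Lam%:E)%E by exact: (far_s h M x0 rho).
(* Lam bounds the far part on B; half of the height sigma / c is left for the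
near part. *)
have [sL|Ls] := leP (sigma / (2 * c)) Lam.
  have sL' : sigma <= 2 * c * Lam by rewrite mulrC -ler_pdivrMr// mulr_gt0.
  apply: (@le_trans _ _ (2 * c * Lam * U `^ p^-1)).
    apply: ler_pM; [exact: ltW|exact: powR_ge0|exact: sL'|].
    by apply: ge0_ler_powR; rewrite ?nnegrE// ltW.
  rewrite /Lam powRM ?invr_ge0 ?(ltW th0) ?(ltW U0)// powRV ?(ltW U0)//.
  have Up : 0 < U `^ p^-1 by rewrite powR_gt0.
  rewrite (_ : 2 * c * _ * _ = 2 * c * Cf * M * th `^ p^-1); last by field; rewrite gt_eqF.
  apply: ler_wpM2r; first exact: powR_ge0.
  apply: ler_wpM2r => //.
  by rewrite ler_pM2l ?mulr_gt0// lerDl powR_ge0.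
pose tau := sigma / (2 * c).
have tau0 : 0 < tau by rewrite divr_gt0// mulr_gt0.
have [G [mG GA Gle]] := near_w h x0 rho tau hh hf rho0 tau0.
have AG : A `<=` G.
  move=> x [xB xs]; apply: GA => //; rewrite -/(I1 x).
  rewrite ltNge; apply/negP => I1le.
  have : (c%:E * (I1 x + I2 x) <= sigma%:E)%E.
    apply: (@le_trans _ _ (c%:E * (tau%:E + Lam%:E))%E).
      apply: lee_wpmul2l; first by rewrite lee_fin ltW.
      by apply: leeD => //; exact: I2le.
    rewrite -EFinD -EFinM lee_fin.
    have -> : sigma = c * (tau + tau) by rewrite /tau; field; rewrite gt_eqF.
    by rewrite ler_pM2l// lerD2l ltW.
  by move=> /(le_trans (rle x)); rewrite leNgt xs.
have B0 : 0 < 2 ^+ (4 * n) * rho by rewrite mulr_gt0// exprn_gt0.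
have mAle : mass u A <= Cn * Cm * (tau `^ (- p) * (th * M `^ p)).
  have : (wmeasure u A <= (Cn * (tau `^ (- p) * mass (phi h) (eball x0 (2 ^+ (4 * n) * rho))))%:E)%E.
    by apply: le_trans Gle; exact: (le_wmeasure lambda hu).
  rewrite -[wmeasure u A]fineK; last first.
    rewrite ge0_fin_numE; last exact: (wmeasure_ge0 lambda _ hu).
    apply: le_lt_trans (ufin x0 rho); apply: (le_wmeasure lambda hu) => //.
    exact: measurable_eball.
  rewrite lee_fin => /le_trans; apply.
  rewrite -[leRHS]mulrA ler_pM2l// mulrCA ler_wpM2l ?powR_ge0//.
  apply: (le_trans (hM x0 _ B0)); rewrite mulrA ler_wpM2r ?powR_ge0//.
  exact: theta_ball.
have Mp : 0 <= M `^ p by exact: powR_ge0.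
apply: (@le_trans _ _ (sigma * ((Cn * Cm * (tau `^ (- p) * (th * M `^ p))) `^ p^-1))).
  rewrite ler_pM2l//; apply: ge0_ler_powR => //; rewrite nnegrE//.
  exact: le_trans mAle.
rewrite powRM ?mulr_ge0 ?powR_ge0 ?(ltW Cn0) ?(ltW th0) ?(le_trans ler01 Ck1)//.
rewrite [((_ `^ (- p)) * _) `^ _]powRM ?mulr_ge0 ?powR_ge0 ?(ltW th0)//.
rewrite [(th * _) `^ _]powRM ?powR_ge0 ?(ltW th0)//.
rewrite -[(M `^ p) `^ _]powRrM mulfV ?gt_eqF// powRr1//.
rewrite -[(tau `^ _) `^ _]powRrM mulNr mulfV ?gt_eqF// powRN powRr1 ?(ltW tau0)//.
have thp : 0 <= th `^ p^-1 by exact: powR_ge0.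
move: (th `^ p^-1) thp ((Cn * Cm) `^ p^-1) (powR_ge0 (Cn * Cm) p^-1) => Y Y0 Z Z0.
rewrite (_ : sigma * _ = 2 * c * Z * M * Y); last first.
  by rewrite /tau; field; rewrite !gt_eqF.
apply: ler_wpM2r => //; apply: ler_wpM2r => //.
by rewrite ler_pM2l ?mulr_gt0// lerDr ltW.
Qed.

End far.

End weights.

(** * Reductions and the theorem *)

Section reductions.
Context {R : realType} {n : nat}.
Local Notation E := (Rn R n).
Local Notation lambda := (@lebesgue R n).

Lemma weight_nonneg_meas (w : E -> R) : weight w -> nonneg_meas w.
Proof.
move=> [w0 wi]; split; first exact: w0.
pose o : E := [tuple (0 : R) | i < n].
have cov : [set: E] = \bigcup_k (eball o k.+1%:R).
  apply/esym; rewrite -subTset => x _.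
  by exists (Num.truncn (l2dist o x)) => //; exact: truncnS_gt.
rewrite cov; apply/measurable_fun_bigcup; first by move=> k; exact: measurable_eball.
move=> k; apply/measurable_EFinP.
have k0 : 0 < k.+1%:R :> R by rewrite ltr0n.
exact: (measurable_int _ (wi o _ k0)).
Qed.

Lemma integrable_ball_fin (g : E -> R) : nonneg_meas g ->
  (forall x rho, 0 < rho -> lambda.-integrable (eball x rho) (fun y => (g y)%:E)) ->
  forall x rho, (wmeasure g (eball x rho) < +oo)%E.
Proof.
move=> hg gi x rho.
have r0 : 0 < `|rho| + 1 by rewrite ltr_wpDl.
apply: (@le_lt_trans _ _ (wmeasure g (eball x (`|rho| + 1)))).
  apply: (le_wmeasure lambda hg); [exact: measurable_eball|exact: measurable_eball|].
  move=> y /= h; apply: (lt_le_trans h); apply: (le_trans (ler_norm _)).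
  by rewrite lerDl ler01.
have /integrableP[_] := gi x _ r0.
suff -> : (\int[lambda]_(y in eball x (`|rho| + 1)%R) `|(g y)%:E|)%E =
  wmeasure g (eball x (`|rho| + 1)) by [].
by apply: eq_integral => y _; rewrite gee0_abs// lee_fin hg.1.
Qed.

(** Doubling propagates a null ball to all concentric balls of radius 2^k rho1. *)
Lemma doubling_null (u : E -> R) (C : R) (x1 : E) (rho1 : R) (A : set E) : nonneg_meas u ->
  (forall x rho, 0 < rho ->
    (wmeasure u (eball x (2 * rho)) <= C%:E * wmeasure u (eball x rho))%E) ->
  0 < rho1 -> wmeasure u (eball x1 rho1) = 0%E ->
  measurable A -> (exists x rho, 0 < rho /\ A `<=` eball x rho) ->
  wmeasure u A = 0%E.
Proof.
move=> hu dbl r1 u1 mA [x [rho [rho0 Ax]]].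
have big k : wmeasure u (eball x1 (2 ^+ k * rho1)) = 0%E.
  elim: k => [|k IH]; first by rewrite expr0 mul1r.
  apply/eqP; rewrite eq_le (wmeasure_ge0 lambda _ hu) andbT exprS -mulrA.
  have k0 : 0 < 2 ^+ k * rho1 by rewrite mulr_gt0// exprn_gt0.
  by apply: (le_trans (dbl _ _ k0)); rewrite IH mule0.
pose d := l2dist x1 x + rho.
have d0 : 0 <= d by rewrite addr_ge0 ?l2dist_ge0// ltW.
pose k := (Num.truncn (n%:R * d / rho1)).+1.
have kd : n%:R * d < 2 ^+ k * rho1.
  rewrite -ltr_pdivrMr//; apply: (lt_trans (truncnS_gt _)).
  by rewrite -natrX ltr_nat ltn_expl.
apply/eqP; rewrite eq_le (wmeasure_ge0 lambda _ hu) andbT -(big k).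
apply: (le_wmeasure lambda hu) => //; first exact: measurable_eball.
move=> y Ay; apply: le_lt_trans kd; apply: l2dist_le => // i.
have yx := Ax _ Ay.
rewrite -(subrK (tnth x i) (tnth x1 i)) -addrA; apply: (le_trans (ler_normD _ _)).
apply: lerD; first exact: coord_le_l2dist.
exact: (le_trans (coord_le_l2dist _ _ _) (ltW yx)).
Qed.

Lemma Dcond_growth (kappa C : R) (theta : R -> R) :
  (forall xi, 0 < xi -> 0 < theta xi) ->
  (forall xi' xi, 0 < xi' -> xi' < xi ->
     theta xi / xi `^ kappa <= C * (theta xi' / xi' `^ kappa)) ->
  forall xi' xi, 0 < xi' -> xi' <= xi ->
  theta xi <= Num.max C 1 * theta xi' * (xi / xi') `^ kappa.
Proof.
move=> th0 thD xi' xi x0; rewrite le_eqVlt => /predU1P[<-|xx].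
  rewrite mulfV ?gt_eqF// powR1 mulr1 ler_peMl ?(ltW (th0 _ x0))//.
  by rewrite le_max lexx orbT.
have xi0 : 0 < xi by exact: lt_trans xx.
have xp : 0 < xi `^ kappa by rewrite powR_gt0.
have := thD _ _ x0 xx; rewrite ler_pdivrMr// => /le_trans; apply.
rewrite powRM ?invr_ge0 ?(ltW x0) ?(ltW xi0)// powRV ?(ltW x0)//.
have x'p : 0 < xi' `^ kappa by rewrite powR_gt0.
rewrite (_ : C * _ * _ = C * (theta xi' * (xi `^ kappa / xi' `^ kappa))); last by ring.
rewrite -mulrA ler_wpM2r ?le_max ?lexx//.
by rewrite mulr_ge0 ?(ltW (th0 _ x0))// divr_ge0 ?powR_ge0.
Qed.

End reductions.

Theorem theorem6p3 (R : realType) (n : nat) (alpha p p' : R)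
  (halpha : 0 < alpha < n%:R) (hp : 1 < p) (hp' : p^-1 + p'^-1 = 1)
  (u v : Rn R n -> R) (hu : weight u) (hv : weight v)
  (hbump : exists2 r : R, 1 < r & exists C : R,
    forall (a : Rn R n) (l : R), 0 < l ->
      let Q := cube a l in
      let vol := @lebesgue R n Q in
      (vol `^ (alpha / n%:R) *
       (vol^-1 * \int[@lebesgue R n]_(x in Q) (u x `^ r)%:E) `^ (r * p)^-1 *
       (vol^-1 * \int[@lebesgue R n]_(x in Q) (v x `^ (p' / p))%:E^-1) `^ p'^-1
       <= C%:E)%E)
  (theta : R -> R) (kappa : R) (hkappa : 0 <= kappa < 1)
  (htheta : Dcond kappa theta) (hDelta2 : Delta2 u) :
  exists2 C' : R, 0 < C' &
    forall f : Rn R n -> R, morrey p theta v u f ->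
      wmorrey p theta u (riesz alpha f) /\
      (wmorrey_norm p theta u (riesz alpha f) <= C'%:E * morrey_norm p theta v u f)%E.
Proof.
have hu' := weight_nonneg_meas hu; have hv' := weight_nonneg_meas hv.
have ufin : forall x rho, (wmeasure u (eball x rho) < +oo)%E.
  by apply: (integrable_ball_fin hu') => x rho rho0; exact: hu.2.
have [th0 thnd [Ck Ck0 thD]] := htheta.
have growth := Dcond_growth th0 thD.
have [Cd Cd0 dbl] := hDelta2.
have p0 : 0 < p by exact: lt_trans hp.
pose o : Rn R n := [tuple (0 : R) | i < n].
have norm_ge0 f : (0 <= morrey_norm p theta v u f)%E.
  apply: (le_trans (poweR_ge0 _ _)); apply: ereal_sup_ubound.
  by exists o, 1; split.
suff key : exists2 C' : R, 0 < C' & forall f : Rn R n -> R, morrey p theta v u f ->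
    forall x0 rho sigma, 0 < rho -> 0 < sigma ->
    ((theta (fine (wmeasure u (eball x0 rho))) `^ p^-1)^-1%:E *
      (sigma%:E * wmeasure u [set y | eball x0 rho y /\
         (sigma%:E < `|riesz alpha f y|)%E] `^ p^-1) <=
     C'%:E * morrey_norm p theta v u f)%E.
  have [C' C'0 key'] := key; exists C'; first exact: C'0.
  move=> f hf.
  have bound : (wmorrey_norm p theta u (riesz alpha f) <=
      C'%:E * morrey_norm p theta v u f)%E.
    apply: ge_ereal_sup => _ [x0 [rho [sigma [rho0 sigma0 ->]]]].
    exact: key'.
  split; last exact: bound.
  split; first by apply: measurable_riesz; exact: hf.1.1.
  apply: (le_lt_trans bound).
  have fin : morrey_norm p theta v u f \is a fin_num by rewrite ge0_fin_numE ?hf.2.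
  by rewrite -(fineK fin) -EFinM ltry.
have mS (f : Rn R n -> R) (x0 : Rn R n) (rho sigma : R) : measurable_fun setT f ->
    measurable [set y | eball x0 rho y /\ (sigma%:E < `|riesz alpha f y|)%E].
  by move=> mf; exact: measurableI (measurable_eball x0 rho) (measurable_riesz_level alpha sigma mf).
have [[x1 [rho1 [rho10 null]]]|pos] := pselect (exists x rho, 0 < rho /\
    wmeasure u (eball x rho) = 0%E).
  exists 1; first exact: ltr01.
  move=> f hf x0 rho sigma rho0 sigma0.
  rewrite [wmeasure u [set y | _]](doubling_null hu' dbl rho10 null).
  - by rewrite poweR0r ?mule0 ?mule_ge0 ?lee_fin// invr_eq0 gt_eqF.
  - by apply: mS; exact: hf.1.1.
  - by exists x0, rho; split => // y [].
have upos : forall x rho, 0 < rho -> (0 < wmeasure u (eball x rho))%E.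
  move=> x rho rho0; rewrite lt0e (wmeasure_ge0 _ _ hu') andbT.
  by apply/eqP => z; apply: pos; exists x, rho.
have [r r1 [C hC]] := hbump.
have [alpha0 alphan] := andP halpha.
have C0 : 0 < Num.max C 1 by rewrite lt_max ltr01 orbT.
have hb : forall (a : Rn R n) (l : R), 0 < l ->
  ((l ^+ n)%:E `^ (alpha / n%:R) *
   ((l ^+ n)%:E^-1 * \int[@lebesgue R n]_(x in cube a l) (u x `^ r)%:E) `^ (r * p)^-1 *
   ((l ^+ n)%:E^-1 * \int[@lebesgue R n]_(x in cube a l) (v x `^ (p' / p))%:E^-1) `^ p'^-1
       <= (Num.max C 1)%:E)%E.
  move=> a l l0; have := hC a l l0; rewrite /= lebesgue_cube// => /le_trans; apply.
  by rewrite lee_fin le_max lexx.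
have Ck1 : 1 <= Num.max Ck 1 by rewrite le_max lexx orbT.
have [C' C'0 est] := weak_estimate alpha0 alphan hp hp' r1 C0 hu' hv' ufin upos hb
  hkappa (ltW Cd0) Ck1 dbl th0 growth.
exists C'; first exact: C'0.
move=> f [[mf fi] foo] x0 rho sigma rho0 sigma0.
pose h (y : Rn R n) : R := `|f y|.
have hh : nonneg_meas h.
  split; first by move=> y; exact: normr_ge0.
  exact: (measurableT_comp (@normr_measurable _ _) mf).
have hphi := phi_nonneg_meas p hv' hh.
have phf : phi_fin p v h.
  by move=> x s s0; apply: (integrable_ball_fin hphi).
set N := morrey_norm p theta v u f in foo *.
have N0 : (0 <= N)%E by exact: norm_ge0.
have NE : N = (fine N)%:E by rewrite fineK// ge0_fin_numE.
have U0 x s : 0 < s -> 0 < mass u (eball x s).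
  by move=> s0; rewrite fine_gt0// upos// ufin.
have hM x s : 0 < s -> mass (phi p v h) (eball x s) <=
    theta (mass u (eball x s)) * fine N `^ p.
  move=> s0; have t0 := th0 _ (U0 x s s0).
  set ph := mass _ _.
  have ph0 : 0 <= ph by apply: fine_ge0; exact: (wmeasure_ge0 _ _ hphi).
  have : (((theta (mass u (eball x s)))^-1%:E * wmeasure (phi p v h) (eball x s))
       `^ p^-1 <= N)%E.
    by apply: ereal_sup_ubound; exists x, s; split.
  rewrite -[wmeasure (phi _ _ _) _]fineK; last first.
    by rewrite ge0_fin_numE ?(wmeasure_ge0 _ _ hphi)//; exact: phf.
  rewrite -/ph NE -EFinM poweR_EFin lee_fin => h1.
  have : ((theta (mass u (eball x s)))^-1 * ph) `^ p^-1 `^ p <= fine N `^ p.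
    apply: ge0_ler_powR => //; rewrite ?nnegrE ?powR_ge0 ?(ltW p0)//.
    exact: fine_ge0.
  rewrite -powRrM mulVf ?gt_eqF// powRr1; last by rewrite mulr_ge0// invr_ge0 ltW.
  by rewrite ler_pdivrMl.
have e := est f (fine N) x0 rho sigma mf phf (fine_ge0 N0) hM rho0 sigma0.
set A := [set y | _] in e *.
have Afin : wmeasure u A \is a fin_num.
  rewrite ge0_fin_numE ?(wmeasure_ge0 _ _ hu')//.
  apply: le_lt_trans (ufin x0 rho).
  apply: (le_wmeasure _ hu'); [exact: mS|exact: measurable_eball|].
  by move=> y [].
rewrite -(fineK Afin) NE poweR_EFin -!EFinM lee_fin.
have tp : 0 < theta (mass u (eball x0 rho)) `^ p^-1.
  by rewrite powR_gt0// th0// U0.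
by rewrite ler_pdivrMl// [leRHS]mulrC.
Qed.
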